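(* Let $\alpha>0$, let $0<p<\infty$, and let $f$ be an entire function. If \[ \int_{\mathbb{C}}|f(z)|^p|z|^2e^{-\alpha|z|^2}\,dA(z)<\infty, \] then \[ \lim_{r\to\infty}r^3M_p^p(r,f)\,e^{-\alpha r^2}=0 . \]
   Context: $dA$ is area measure and $M_p(r,f)=\left(\int_0^{2\pi}|f(re^{i\theta})|^p\,d\theta\right)^{1/p}$. *)

(* Defs.v *)
From HB Require Import structures.
From mathcomp Require Import all_boot all_order all_algebra.
From mathcomp Require Import all_classical all_reals all_analysis.
From mathcomp.real_closed Require Import complex.
Set Implicit Arguments. Unset Strict Implicit. Unset Printing Implicit Defensive.
Import Order.TTheory GRing.Theory Num.Theory.
Local Open Scope ring_scope.
Local Open Scope complex_scope.

Definition C_differentiable_at (R : realType) (f : complex R -> complex R)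
    (z : complex R) : Prop :=
  exists d : complex R, forall eps : R, 0 < eps -> exists2 delta : R, 0 < delta &
    forall h : complex R, h != 0 -> Normc.normc h < delta ->
      Normc.normc ((f (z + h) - f z) / h - d) < eps.

Definition entire (R : realType) (f : complex R -> complex R) : Prop :=
  forall z, C_differentiable_at f z.

Local Open Scope ereal_scope.

Definition Mpp (R : realType) (p r : R) (f : complex R -> complex R) : \bar R :=
  \int[@lebesgue_measure R]_(t in `[0%R, (2 * pi)%R])
     ((Normc.normc (f ((r * cos t)%R +i* (r * sin t)%R))) `^ p)%:E.

Definition weighted_integral (R : realType) (p alpha : R)
    (f : complex R -> complex R) : \bar R :=
  \int[(@lebesgue_measure R \x @lebesgue_measure R)]_(xy in [set: R * R])
     ((Normc.normc (f (xy.1 +i* xy.2))) `^ p * (xy.1 ^+ 2 + xy.2 ^+ 2)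
        * expR (- (alpha * (xy.1 ^+ 2 + xy.2 ^+ 2))))%:E.

(* Main.v *)
Require Import Defs.
From HB Require Import structures.
From mathcomp Require Import all_boot all_order all_algebra.
From mathcomp Require Import all_classical all_reals all_analysis.
From mathcomp.real_closed Require Import complex.
From mathcomp Require Import measurable_realfun.
From mathcomp Require Import ring lra.
Import Order.TTheory GRing.Theory Num.Theory.
Import numFieldNormedType.Exports.
Import Normc.
Local Open Scope classical_set_scope.
Local Open Scope ring_scope.
Local Notation Re := complex.Re.
Local Notation Im := complex.Im.
Set Implicit Arguments.
Unset Strict Implicit.

(** The argument is local and avoids Hardy's convexity theorem.  For entire f the
    density |f|^p exp (- alpha |z|^2) is dominated, at every point z, by a
    constant (independent of z) times its integral over the square of side 2
    centred at z.  Integrating this over the circle |z| = r and exchanging the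
    integrals, each w is seen from an arc of angular measure O(1/r), and only if
    |w| >= r - 2; hence r^3 M_p^p(r, f) exp (- alpha r^2) is at most a constant
    times the integral of |f|^p |w|^2 exp (- alpha |w|^2) over |w| >= r / 2,
    which tends to 0.

    The local estimate is proved first without weight and for p = 1: Goursat's
    theorem applied to (g - g(z0)) / (z - z0) bounds |g(z0)| by the mean of |g|
    over the boundary of a rectangle around z0, whose sides are then chosen by
    averaging.  The case of arbitrary p > 0 follows by applying p = 1 at the
    maximum point of |g| weighted by a power of the distance to the boundary,
    and the Gaussian weight is introduced by multiplying f by a polynomial
    approximation of exp (- (2 alpha / p) conj z0 (z - z0)). *)

(** * Complex differentiability *)

Section complex_differentiability.
Local Open Scope complex_scope.
Context {R : realType}.
Implicit Types (f g : R[i] -> R[i]) (z w : R[i]).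
Let K : numFieldType := R[i].

Lemma normc_ge0 z : 0 <= normc z.
Proof. by case: z => a b; rewrite sqrtr_ge0. Qed.

Lemma normc_gt0 z : z != 0 -> 0 < normc z.
Proof.
move=> z0; rewrite lt_neqAle normc_ge0 andbT eq_sym.
by apply: contra z0 => /eqP/eq0_normc ->.
Qed.

Lemma normr_Re_le z : `|Re z| <= normc z.
Proof. by case: z => a b /=; rewrite -sqrtr_sqr ler_wsqrtr // lerDl sqr_ge0. Qed.

Lemma normr_Im_le z : `|Im z| <= normc z.
Proof.
by case: z => a b /=; rewrite -sqrtr_sqr ler_wsqrtr // lerDr sqr_ge0.
Qed.

Lemma normc_le_add z : normc z <= `|Re z| + `|Im z|.
Proof.
case: z => a b /=; rewrite -[leRHS]ger0_norm ?addr_ge0// -sqrtr_sqr.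
rewrite ler_wsqrtr// sqrrD !real_normK ?num_real//.
by rewrite -addrA lerD2l lerDr mulrn_wge0// mulr_ge0.
Qed.

Lemma normcX z n : normc (z ^+ n) = normc z ^+ n.
Proof.
elim: n => [|n ih]; first by rewrite !expr0 normc1.
by rewrite !exprS normcM ih.
Qed.

Lemma normcB z w : normc (z - w) = normc (w - z).
Proof. by rewrite -[RHS](normcN (w - z)) opprB. Qed.

(** The norm on [R[i]] is [normc] embedded in [R[i]], and a positive element of [R[i]] is a positive
    real, so the two limits agree. This gives access to the general differentiation rules. *)
Lemma C_differentiable_atP f z : C_differentiable_at f z <-> @derivable K K K f z 1.
Proof.
split.
- move=> [d hd]; apply/cvg_ex; exists d; apply/cvgrPdist_lt => e.
  case: e => e1 e2; rewrite ltcE /= => /andP[/eqP -> e0].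
  have [de de0 H] := hd _ e0.
  exists (de%:C); first by rewrite /= ltcR.
  move=> h /=; rewrite sub0r normrN => hde h0.
  rewrite distrC complexr0 -[X in X < _]/((normc _)%:C) ltcR.
  rewrite [h%:A]mulr1 (addrC h) -[_ *: _]mulrC.
  by apply: H => //; rewrite -ltcR.
- move=> /cvg_ex[d /cvgrPdist_lt H]; exists d => e e0.
  have /H[/= [d1 d2]] : 0 < e%:C :> R[i] by rewrite ltcR.
  rewrite ltcE /= => /andP[/eqP -> d0] {}H; exists d1 => // h h0 hd.
  have := H h; rewrite /ball/= sub0r normrN complexr0.
  rewrite -[X in X < _]/((normc _)%:C) ltcR => /(_ hd h0).
  rewrite distrC -[X in X < _]/((normc _)%:C) ltcR.
  by rewrite [h%:A]mulr1 (addrC h) -[_ *: _]mulrC.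
Qed.

(** Division-free form of differentiability, in which [w = z] is allowed. *)
Lemma C_differentiable_at_approx f z : C_differentiable_at f z ->
  exists d : R[i], forall eps : R, 0 < eps -> exists2 delta : R, 0 < delta &
    forall w, normc (w - z) < delta ->
      normc (f w - f z - d * (w - z)) <= eps * normc (w - z).
Proof.
move=> [d H]; exists d => e e0; have [de de0 {}H] := H _ e0.
exists de => // w wz; have [->|wz0] := eqVneq w z.
  by rewrite !subrr mulr0 subrr normc0 mulr0.
have nz : w - z != 0 by rewrite subr_eq0.
have := H _ nz wz; rewrite (addrC z) subrK.
rewrite -(@ltr_pM2r _ (normc (w - z))) ?normc_gt0// -normcM.
by rewrite mulrBl divfK// => /ltW.
Qed.

Lemma C_differentiable_at_cont f z : C_differentiable_at f z ->
  forall eps : R, 0 < eps -> exists2 delta : R, 0 < delta &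
    forall w, normc (w - z) < delta -> normc (f w - f z) < eps.
Proof.
move=> /C_differentiable_at_approx[d H] e e0.
have [de de0 {}H] := H _ ltr01.
have nd0 := normc_ge0 d.
have k0 : 0 < 1 + normc d by rewrite ltr_pwDl.
exists (Num.min de (e / (1 + normc d))).
  by rewrite lt_min de0 divr_gt0.
move=> w; rewrite lt_min => /andP[/H wz]; rewrite ltr_pdivlMr//.
apply: le_lt_trans; rewrite -[f w - f z](subrK (d * (w - z))).
rewrite (le_trans (le_normcD _ _))// normcM [leRHS]mulrDr mulr1.
by rewrite lerD// ?(mulrC (normc d))// (le_trans wz)// mul1r.
Qed.

End complex_differentiability.

Section pointwise_derivable.
Context {K : numFieldType}.
Implicit Types (f g : K -> K) (z c : K).

Lemma derivable_mul f g z : derivable f z 1 -> derivable g z 1 ->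
  derivable (fun w => f w * g w) z 1.
Proof. exact: derivableM. Qed.

Lemma derivable_sub_cst f c z : derivable f z 1 ->
  derivable (fun w => f w - c) z 1.
Proof. by move=> fz; apply: derivableB => //; exact: derivable_cst. Qed.

End pointwise_derivable.

Section entire_functions.
Context {R : realType}.
Implicit Types (f g : R[i] -> R[i]) (z w : R[i]).
Let K : numFieldType := R[i].

Lemma entire_cst (c : R[i]) : entire (fun _ => c).
Proof. by move=> z; apply/C_differentiable_atP; exact: (@derivable_cst K K K). Qed.

Lemma entire_id : entire (@id R[i]).
Proof. by move=> z; apply/C_differentiable_atP; exact: (@derivable_id K K). Qed.

Lemma C_differentiable_atM f g z : C_differentiable_at f z ->
  C_differentiable_at g z -> C_differentiable_at (fun w => f w * g w) z.
Proof.
move=> /C_differentiable_atP fz /C_differentiable_atP gz.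
by apply/C_differentiable_atP; exact: (@derivable_mul K f g z fz gz).
Qed.

Lemma C_differentiable_at_sub_cst f (c : R[i]) z : C_differentiable_at f z ->
  C_differentiable_at (fun w => f w - c) z.
Proof.
move=> /C_differentiable_atP fz; apply/C_differentiable_atP.
exact: (@derivable_sub_cst K f c z fz).
Qed.

Lemma C_differentiable_at_inv f z : f z != 0 -> C_differentiable_at f z ->
  C_differentiable_at (fun w => (f w)^-1) z.
Proof.
move=> fz0 /C_differentiable_atP fz; apply/C_differentiable_atP.
exact: (@derivableV K K f z 1 fz0 fz).
Qed.

Lemma entireM f g : entire f -> entire g -> entire (fun w => f w * g w).
Proof. by move=> ef eg z; exact: C_differentiable_atM. Qed.

Lemma entireX f n : entire f -> entire (fun w => f w ^+ n).
Proof.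
move=> ef; elim: n => [|n ih].
  rewrite (_ : (fun _ => _) = fun=> 1); first exact: entire_cst.
  by apply/funext => w; rewrite expr0.
rewrite (_ : (fun _ => _) = fun w => f w * f w ^+ n); first exact: entireM.
by apply/funext => w; rewrite exprS.
Qed.

End entire_functions.

(** * Bisection and integrals over segments *)

Section bisection.
Context {R : realType}.

(** The supremum of the left endpoints works: they increase, and each of them lies below every right
    endpoint. *)
Lemma nested_intervals (u : nat -> R) (w : R) : 0 <= w ->
  (forall n, u n <= u n.+1 /\ u n.+1 + w / 2 ^+ n.+1 <= u n + w / 2 ^+ n) ->
  exists x, forall n, u n <= x <= u n + w / 2 ^+ n.
Proof.
move=> w0 H.
have wn n : 0 <= w / 2 ^+ n by rewrite divr_ge0 ?exprn_ge0.
have inc m n : (m <= n)%N -> u m <= u n.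
  apply: (homo_leq (r := fun a b : R => a <= b)) => //; first exact: le_trans.
  by move=> k; have [] := H k.
have dec m n : (m <= n)%N -> u n + w / 2 ^+ n <= u m + w / 2 ^+ m.
  apply: (homo_leq (f := fun k => u k + w / 2 ^+ k) (r := fun a b : R => b <= a)).
  - by move=> a; exact: lexx.
  - by move=> b a c ab bc; exact: le_trans bc ab.
  - by move=> k; have [] := H k.
have ub m n : u m <= u n + w / 2 ^+ n.
  have [mn|nm] := leqP m n; first by rewrite (le_trans (inc _ _ mn))// lerDl.
  by rewrite (le_trans _ (dec _ _ (ltnW nm)))// lerDl.
have hs : has_sup (range u).
  by split; [exists (u 0%N), 0%N|exists (u 0%N + w / 2 ^+ 0) => _ [n _ <-]].
exists (sup (range u)) => n; apply/andP; split.
  by apply: sup_upper_bound => //; exists n.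
by apply: ge_sup; [exists (u 0%N), 0%N|move=> _ [m _ <-]].
Qed.

(** Iterating the choice of a bad quarter makes both coordinates of the corners run through nested
    intervals. [Bad] depends on the depth [n] so that it may carry a threshold shrinking with
    [n]. *)
Lemma rectangle_bisection (Bad : nat -> R -> R -> Prop) (w h a0 c0 : R) :
  0 <= w -> 0 <= h -> Bad 0%N a0 c0 ->
  (forall n a c, Bad n a c -> exists i j : bool,
    Bad n.+1 (a + i%:R * (w / 2 ^+ n.+1)) (c + j%:R * (h / 2 ^+ n.+1))) ->
  exists x y, [/\ a0 <= x <= a0 + w, c0 <= y <= c0 + h &
    forall n, exists a c, [/\ Bad n a c, a <= x <= a + w / 2 ^+ n &
      c <= y <= c + h / 2 ^+ n]].
Proof.
move=> w0 h0 bad0 badS.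
(* The choice function must be total, hence the implication: where [Bad] fails, any corner will
   do. *)
have [|F HF] := @choice (nat * (R * R)) (R * R) (fun q b =>
    Bad q.1 q.2.1 q.2.2 -> Bad q.1.+1 b.1 b.2 /\
    exists i j : bool, b.1 = q.2.1 + i%:R * (w / 2 ^+ q.1.+1) /\
                       b.2 = q.2.2 + j%:R * (h / 2 ^+ q.1.+1)).
  move=> [n [a c]] /=; have [/badS[i [j bij]]|] := pselect (Bad n a c).
    exists (a + i%:R * (w / 2 ^+ n.+1), c + j%:R * (h / 2 ^+ n.+1)) => _ /=.
    by split => //; exists i, j.
  by move=> nb; exists (a, c).
pose s := fix s n := if n is m.+1 then F (m, s m) else (a0, c0).
have sB n : Bad n (s n).1 (s n).2.
  by elim: n => //= n ih; have [] := HF (n, s n) ih.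
have half (v : R) n : v / 2 ^+ n.+1 = (v / 2 ^+ n) / 2.
  by rewrite exprSr invfM mulrA mulrAC.
have nest (v u u' : R) n (i : bool) : 0 <= v ->
    u' = u + i%:R * (v / 2 ^+ n.+1) ->
    u <= u' /\ u' + v / 2 ^+ n.+1 <= u + v / 2 ^+ n.
  move=> v0 ->; rewrite half.
  have : 0 <= v / 2 ^+ n by rewrite divr_ge0 ?exprn_ge0.
  by move: (v / 2 ^+ n) => t t0; case: i => /=; split; lra.
have [x Hx] : exists x, forall n, (s n).1 <= x <= (s n).1 + w / 2 ^+ n.
  apply: nested_intervals => // n; have [_ [i [j [e _]]]] := HF (n, s n) (sB n).
  exact: nest e.
have [y Hy] : exists y, forall n, (s n).2 <= y <= (s n).2 + h / 2 ^+ n.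
  apply: nested_intervals => // n; have [_ [i [j [_ e]]]] := HF (n, s n) (sB n).
  exact: nest e.
exists x, y; split.
- by have := Hx 0%N; rewrite /= expr0 divr1.
- by have := Hy 0%N; rewrite /= expr0 divr1.
- by move=> n; exists (s n).1, (s n).2; split.
Qed.

End bisection.

Section segment_integral.
Context {R : realType}.
Local Notation mu := (@lebesgue_measure R).
Implicit Types (k l : R -> R) (a b m : R).

Lemma lebesgue_measure_segment a b : a <= b -> mu `[a, b] = (b - a)%:E.
Proof.
rewrite lebesgue_measure_itv/= lte_fin.
by case: ltgtP => [//|//|-> _]; rewrite subrr.
Qed.

Lemma continuous_integrable_segment k a b : continuous k ->
  mu.-integrable `[a, b] (EFin \o k).
Proof.
move=> ck; apply: continuous_compact_integrable; first exact: segment_compact.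
exact: continuous_subspaceT.
Qed.

Lemma Rintegral_segment_split k a m b : continuous k -> a <= m -> m <= b ->
  \int[mu]_(t in `[a, b]) k t =
  \int[mu]_(t in `[a, m]) k t + \int[mu]_(t in `[m, b]) k t.
Proof.
move=> ck am mb.
have ik := continuous_integrable_segment _ _ ck.
rewrite -(@Rintegral_itv_obnd_cbnd _ m).
  rewrite -(@Rintegral_itvB _ k (BLeft a) (BRight b) m) ?bnd_simp//.
  by rewrite addrCA subrr addr0.
apply: integrableS (ik m b) => //.
by apply: subset_itvr; rewrite bnd_simp.
Qed.

Lemma Rintegral_segment_le k a b (M : R) : continuous k -> a <= b ->
  (forall t, a <= t <= b -> k t <= M) ->
  \int[mu]_(t in `[a, b]) k t <= M * (b - a).
Proof.
move=> ck ab H.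
rewrite (_ : M * (b - a) = \int[mu]_(t in `[a, b]) M).
  apply: le_Rintegral; first exact: measurable_itv.
  - exact: continuous_integrable_segment.
  - by apply: (@continuous_integrable_segment (cst M)) => x; exact: cvg_cst.
  - by move=> t /=; rewrite in_itv/=; exact: H.
by rewrite Rintegral_cst//= lebesgue_measure_segment.
Qed.

Lemma Rintegral_segment_norm_le k a b (M : R) : continuous k -> a <= b ->
  (forall t, a <= t <= b -> `|k t| <= M) ->
  `|\int[mu]_(t in `[a, b]) k t| <= M * (b - a).
Proof.
move=> ck ab H.
apply: (le_trans (le_normr_Rintegral _ (continuous_integrable_segment _ _ ck))).
  by [].
apply: Rintegral_segment_le => // x.
by apply: cvg_norm; exact: ck.
Qed.

Lemma Rintegral_segment_sub k l a b : continuous k -> continuous l ->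
  \int[mu]_(t in `[a, b]) (k t - l t) =
  \int[mu]_(t in `[a, b]) k t - \int[mu]_(t in `[a, b]) l t.
Proof.
by move=> ck cl; apply: RintegralB => //; exact: continuous_integrable_segment.
Qed.

(** Turns a pointwise bound into a bound over one side of a rectangle; [s] will be the sign [1] or
    [-1] given by the orientation of that side. *)
Lemma Rintegral_segment_scale_le k l a b (s B M : R) :
  continuous k -> continuous l -> a <= b ->
  (forall t, a <= t <= b -> s * k t <= B * l t - M) ->
  s * \int[mu]_(t in `[a, b]) k t <= B * \int[mu]_(t in `[a, b]) l t - M * (b - a).
Proof.
move=> ck cl ab H; have ik := continuous_integrable_segment a b ck.
have il := continuous_integrable_segment a b cl.
have cM (r : R) (h : R -> R) : continuous h -> continuous (fun t => r * h t).
  by move=> ch t; apply: cvgM; [exact: cvg_cst|exact: ch].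
have cM' : continuous (fun _ : R => M) by move=> t; exact: cvg_cst.
rewrite -!RintegralZl//.
have -> : M * (b - a) = \int[mu]_(t in `[a, b]) M.
  by rewrite Rintegral_cst//= lebesgue_measure_segment.
rewrite -Rintegral_segment_sub//; last exact: cM.
apply: le_Rintegral; first exact: measurable_itv.
- by apply: continuous_integrable_segment; exact: cM.
- apply: continuous_integrable_segment => t.
  by apply: cvgB; [exact: cM|apply: cvg_cst].
- by move=> t /=; rewrite in_itv/=; exact: H.
Qed.

End segment_integral.

(** * Goursat's theorem for differentiable closed forms *)

Section goursat.
Context {R : realType}.
Local Notation mu := (@lebesgue_measure R).
Implicit Types (P Q : R -> R -> R) (a b c d x y : R).

(** The counterclockwise line integral of [P dx + Q dy] along the boundary of the rectangle with
    sides [[a, b]] and [[c, d]]. *)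
Definition rectangle_circulation P Q a b c d : R :=
  \int[mu]_(x in `[a, b]) P x c - \int[mu]_(x in `[a, b]) P x d
  + (\int[mu]_(y in `[c, d]) Q b y - \int[mu]_(y in `[c, d]) Q a y).

(** The shared coefficient [e] expresses dP/dy = dQ/dx. Only differentiability at the point is
    asked, with no continuity of the derivatives. *)
Definition closed_form_at P Q x y := exists p e q : R,
  forall eps : R, 0 < eps -> exists2 delta : R, 0 < delta &
  forall x' y', `|x' - x| < delta -> `|y' - y| < delta ->
  `|P x' y' - P x y - p * (x' - x) - e * (y' - y)|
     <= eps * (`|x' - x| + `|y' - y|) /\
  `|Q x' y' - Q x y - e * (x' - x) - q * (y' - y)|
     <= eps * (`|x' - x| + `|y' - y|).

Variables P Q : R -> R -> R.
Hypothesis cP : forall y, continuous (P ^~ y).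
Hypothesis cQ : forall x, continuous (Q x).
Local Notation circ := (rectangle_circulation P Q).

Lemma rectangle_circulation_splitx a m b c d : a <= m -> m <= b ->
  circ a b c d = circ a m c d + circ m b c d.
Proof.
move=> am mb; rewrite /rectangle_circulation.
rewrite (Rintegral_segment_split (@cP c) am mb).
rewrite (Rintegral_segment_split (@cP d) am mb).
ring.
Qed.

Lemma rectangle_circulation_splity a b c m d : c <= m -> m <= d ->
  circ a b c d = circ a b c m + circ a b m d.
Proof.
move=> cm md; rewrite /rectangle_circulation.
rewrite (Rintegral_segment_split (@cQ a) cm md).
rewrite (Rintegral_segment_split (@cQ b) cm md).
ring.
Qed.

(** The linear parts cancel: the horizontal sides contribute [- e * h * w], the vertical ones
    [e * w * h], and only the errors of the two expansions remain. *)
Lemma rectangle_circulation_small x y : closed_form_at P Q x y ->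
  forall eps : R, 0 < eps -> exists2 delta : R, 0 < delta &
  forall a c w h, 0 <= w -> 0 <= h -> w < delta -> h < delta ->
    a <= x <= a + w -> c <= y <= c + h ->
    `|circ a (a + w) c (c + h)| <= eps * (w + h) ^+ 2.
Proof.
move=> [p [e [q H]]] eps eps0.
(* Each difference between opposite sides collects two errors, hence half of [eps]. *)
have [|de de0 {}H] := H (eps / 2); first by rewrite divr_gt0.
exists de => // a c w h w0 h0 wde hde /andP[ax xa] /andP[cy yc].
have aw : a <= a + w by rewrite lerDl.
have ch : c <= c + h by rewrite lerDl.
have dist (u t l : R) : u <= t <= u + l -> forall t', u <= t' <= u + l ->
    `|t' - t| <= l.
  by move=> /andP[? ?] t' /andP[? ?]; rewrite ler_norml; apply/andP; split; lra.
have dx x' : a <= x' <= a + w -> `|x' - x| <= w by apply: dist; apply/andP.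
have dy y' : c <= y' <= c + h -> `|y' - y| <= h by apply: dist; apply/andP.
have E x' y' : a <= x' <= a + w -> c <= y' <= c + h ->
    `|P x' y' - P x y - p * (x' - x) - e * (y' - y)| <= eps / 2 * (w + h) /\
    `|Q x' y' - Q x y - e * (x' - x) - q * (y' - y)| <= eps / 2 * (w + h).
  move=> /dx xx /dy yy.
  have [] := H x' y' (le_lt_trans xx wde) (le_lt_trans yy hde).
  have k : eps / 2 * (`|x' - x| + `|y' - y|) <= eps / 2 * (w + h).
    by rewrite ler_wpM2l ?lerD// divr_ge0// ltW.
  by split; exact: le_trans k.
have cst_cont (r : R) : continuous (fun _ : R => r) by move=> t; exact: cvg_cst.
have cstI (r u l : R) : 0 <= l ->
    \int[mu]_(t in `[u, u + l]) r = r * l.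
  by move=> l0; rewrite Rintegral_cst//= lebesgue_measure_segment ?lerDl//=
    addrAC subrr add0r.
have IP : `|\int[mu]_(x in `[a, a + w]) P x c
     - \int[mu]_(x in `[a, a + w]) P x (c + h) + e * h * w|
    <= eps * (w + h) * w.
  rewrite -Rintegral_segment_sub// -(cstI (e * h) a)//.
  have -> : \int[mu]_(t in `[a, (a + w)]) (P t c - P t (c + h)) +
      \int[mu]_(t in `[a, (a + w)]) (e * h) =
      \int[mu]_(t in `[a, (a + w)]) (P t c - P t (c + h) - - (e * h)).
    rewrite [RHS]Rintegral_segment_sub//; last first.
      by move=> t; apply: cvgB; exact: cP.
    by rewrite !cstI// mulNr opprK.
  have -> : eps * (w + h) * w = eps * (w + h) * (a + w - a) by ring.
  apply: Rintegral_segment_norm_le => //.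
    by move=> t; apply: cvgB; [apply: cvgB; exact: cP|exact: cvg_cst].
  move=> t tw.
  have [E1 _] := E t c tw ltac:(by rewrite lexx).
  have [E2 _] := E t (c + h) tw ltac:(by rewrite lexx ch).
  have -> : P t c - P t (c + h) - - (e * h) =
    (P t c - P x y - p * (t - x) - e * (c - y)) -
    (P t (c + h) - P x y - p * (t - x) - e * (c + h - y)) by ring.
  apply: (le_trans (ler_normB _ _)).
  by move: E1 E2; move: `|_| `|_| => u v; lra.
have IQ : `|\int[mu]_(y in `[c, c + h]) Q (a + w) y
     - \int[mu]_(y in `[c, c + h]) Q a y - e * w * h|
    <= eps * (w + h) * h.
  rewrite -Rintegral_segment_sub// -(cstI (e * w) c)//.
  rewrite -Rintegral_segment_sub//; last first.
    by move=> t; apply: cvgB; exact: cQ.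
  have -> : eps * (w + h) * h = eps * (w + h) * (c + h - c) by ring.
  apply: Rintegral_segment_norm_le => //.
    by move=> t; apply: cvgB; [apply: cvgB; exact: cQ|exact: cvg_cst].
  move=> t th.
  have [_ E1] := E a t ltac:(by rewrite lexx) th.
  have [_ E2] := E (a + w) t ltac:(by rewrite lexx aw) th.
  have -> : Q (a + w) t - Q a t - e * w =
    (Q (a + w) t - Q x y - e * (a + w - x) - q * (t - y)) -
    (Q a t - Q x y - e * (a - x) - q * (t - y)) by ring.
  apply: (le_trans (ler_normB _ _)).
  by move: E1 E2; move: `|_| `|_| => u v; lra.
have -> : eps * (w + h) ^+ 2 = eps * (w + h) * w + eps * (w + h) * h by ring.
apply: le_trans (lerD IP IQ).
rewrite (le_trans _ (ler_normD _ _))// le_eqVlt; apply/orP; left.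
by rewrite /rectangle_circulation; apply/eqP; congr (`|_|); ring.
Qed.

(** Goursat's bisection: if the circulation exceeded [eta], one quarter would exceed [eta / 4], and
    so on down to a limit point. There closedness bounds the circulation at depth [n] by
    [eps * (W n + H n) ^+ 2], which is exactly [eta / 4 ^+ n] for [eps = eta / (w + h) ^+ 2]. *)
Lemma goursat_rectangle a w c h : 0 < w -> 0 < h ->
  (forall x y, a <= x <= a + w -> c <= y <= c + h -> closed_form_at P Q x y) ->
  circ a (a + w) c (c + h) = 0.
Proof.
move=> w0 h0 cl; apply/eqP; rewrite -normr_le0; apply/ler_addgt0Pl => eta eta0.
rewrite addr0 leNgt; apply/negP => big.
pose W n : R := w / 2 ^+ n; pose H n : R := h / 2 ^+ n.
have W0 n : 0 < W n by rewrite divr_gt0 ?exprn_gt0.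
have H0 n : 0 < H n by rewrite divr_gt0 ?exprn_gt0.
have half (v : R) n : v / 2 ^+ n = v / 2 ^+ n.+1 + v / 2 ^+ n.+1.
  by rewrite exprSr; field; rewrite expf_neq0.
pose Bad n u v := eta / 4 ^+ n < `|circ u (u + W n) v (v + H n)|.
have bad0 : Bad 0%N a c by rewrite /Bad /W /H !expr0 !divr1.
have badS n u v : Bad n u v -> exists i j : bool,
    Bad n.+1 (u + i%:R * W n.+1) (v + j%:R * H n.+1).
  rewrite /Bad => B; apply: contrapT => N.
  have G (i j : bool) : `|circ (u + i%:R * W n.+1)
      (u + i%:R * W n.+1 + W n.+1) (v + j%:R * H n.+1)
      (v + j%:R * H n.+1 + H n.+1)| <= eta / 4 ^+ n.+1.
    by rewrite leNgt; apply/negP => B'; apply: N; exists i, j.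
  move: B; apply/negP; rewrite -leNgt /W /H (half w) (half h) !addrA.
  have := (G false false, G false true, G true false, G true true).
  rewrite /= !mul0r !mul1r !addr0 => -[[[G1 G2] G3] G4].
  have Wn := ltW (W0 n.+1); have Hn := ltW (H0 n.+1).
  rewrite (@rectangle_circulation_splitx _ (u + W n.+1)) ?lerDl//.
  rewrite (@rectangle_circulation_splity u _ _ (v + H n.+1)) ?lerDl//.
  rewrite (@rectangle_circulation_splity (u + W n.+1) _ _ (v + H n.+1)) ?lerDl//.
  rewrite (le_trans (ler_normD _ _))//.
  have -> : eta / 4 ^+ n = (eta / 4 ^+ n.+1 + eta / 4 ^+ n.+1) +
     (eta / 4 ^+ n.+1 + eta / 4 ^+ n.+1).
    by rewrite exprSr; field; rewrite expf_neq0.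
  by rewrite lerD// (le_trans (ler_normD _ _))// lerD.
have [x [y [xa yc near_xy]]] :=
  rectangle_bisection (ltW w0) (ltW h0) bad0 badS.
pose eps := eta / (w + h) ^+ 2.
have wh0 : 0 < w + h by rewrite addr_gt0.
have eps0 : 0 < eps by rewrite divr_gt0// exprn_gt0.
have [de de0 small] := rectangle_circulation_small (cl _ _ xa yc) eps0.
have [n ln] : exists n, (w + h) / 2 ^+ n < de.
  have [n hn] := ltr_add_invr (divr_gt0 de0 wh0).
  exists n; rewrite ltr_pdivrMr ?exprn_gt0//.
  rewrite add0r ltr_pdivlMr// in hn.
  have n2 : (n.+1%:R : R) <= 2 ^+ n by rewrite -natrX ler_nat ltn_expl.
  rewrite (@lt_le_trans _ _ (de * n.+1%:R))// ?ler_pM2l//.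
  by rewrite -ltr_pdivrMr// mulrC.
have [u [v [bad ux vy]]] := near_xy n.
have Wde : W n < de.
  by apply: le_lt_trans ln; rewrite ler_pM2r ?invr_gt0 ?exprn_gt0// lerDl ltW.
have Hde : H n < de.
  by apply: le_lt_trans ln; rewrite ler_pM2r ?invr_gt0 ?exprn_gt0// lerDr ltW.
have := small u v _ _ (ltW (W0 n)) (ltW (H0 n)) Wde Hde ux vy.
rewrite leNgt; move/negP; apply; apply: le_lt_trans bad.
rewrite /W /H /eps -mulrDl expr_div_n -exprM mulnC exprM.
rewrite (_ : 2 ^+ 2 = 4 :> R); last by rewrite expr2; lra.
rewrite le_eqVlt; apply/orP; left; apply/eqP.
by field; rewrite expf_neq0//= gt_eqF.
Qed.

End goursat.

Section punctured_goursat.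
Context {R : realType}.
Implicit Types (P Q : R -> R -> R) (a b c d x y : R).

Variables P Q : R -> R -> R.
Hypothesis cP : forall y, continuous (P ^~ y).
Hypothesis cQ : forall x, continuous (Q x).
Local Notation circ := (rectangle_circulation P Q).

(* Excising a small square around the exceptional point leaves four rectangles
   on which the form is closed, and boundedness makes the small square's
   contribution negligible. *)
Lemma goursat_punctured_rectangle a b c d x0 y0 (M delta : R) :
  a < x0 < b -> c < y0 < d ->
  (forall x y, (x, y) != (x0, y0) -> closed_form_at P Q x y) ->
  0 < delta -> (forall x y, `|x - x0| <= delta -> `|y - y0| <= delta ->
    `|P x y| <= M /\ `|Q x y| <= M) ->
  circ a b c d = 0.
Proof.
move=> /andP[ax xb] /andP[cy yd] cl de0 bd.
have M0 : 0 <= M.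
  have [|| + _] := bd x0 y0; rewrite ?subrr ?normr0 ?(ltW de0)//.
  exact: le_trans.
have zero u v p q : u < v -> p < q ->
    (forall x y, u <= x <= v -> p <= y <= q -> (x, y) != (x0, y0)) ->
    circ u v p q = 0.
  move=> uv pq H; have := @goursat_rectangle _ P Q cP cQ u (v - u) p (q - p).
  rewrite !subr_gt0 uv pq ![_ + (_ - _)]addrC !subrK; apply => //.
  by move=> x y xuv ypq; apply: cl; exact: H.
apply/eqP; rewrite -normr_le0; apply/ler_addgt0Pl => eta eta0; rewrite addr0.
(* Half-side of the excised square: at most [delta] for the bound [M], at most [eta / (8 * (M + 1))]
   since the four sides contribute at most [8 * M * t], and small enough to stay inside the
   rectangle. *)
pose t := Num.min (Num.min delta (eta / (8 * (M + 1))))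
  (Num.min (Num.min ((x0 - a) / 2) ((b - x0) / 2))
           (Num.min ((y0 - c) / 2) ((d - y0) / 2))).
have t0 : 0 < t.
  by rewrite !lt_min de0 !divr_gt0 ?subr_gt0 ?mulr_gt0 ?ltr_pwDr.
have : t <= t by [].
rewrite {2}/t !le_min => /and3P[/andP[tde teta] /andP[ta tb] /andP[tc td]].
(* The pieces to the left, to the right, below and above the square are cut off in turn, each having
   zero circulation. *)
rewrite (@rectangle_circulation_splitx _ P Q cP a (x0 - t)); [|lra|lra].
rewrite (zero a) ?add0r; [|lra|lra|]; last first.
  move=> x y /andP[? ?] _; apply/eqP => -[xx _]; lra.
rewrite (@rectangle_circulation_splitx _ P Q cP _ (x0 + t) b); [|lra|lra].
rewrite (zero (x0 + t)) ?addr0; [|lra|lra|]; last first.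
  move=> x y /andP[? ?] _; apply/eqP => -[xx _]; lra.
rewrite (@rectangle_circulation_splity _ P Q cQ _ _ c (y0 - t)); [|lra|lra].
rewrite (zero _ _ c) ?add0r; [|lra|lra|]; last first.
  move=> x y _ /andP[? ?]; apply/eqP => -[_ yy]; lra.
rewrite (@rectangle_circulation_splity _ P Q cQ _ _ _ (y0 + t) d); [|lra|lra].
rewrite (zero _ _ (y0 + t)) ?addr0; [|lra|lra|]; last first.
  move=> x y _ /andP[? ?]; apply/eqP => -[_ yy]; lra.
have near (z0 z : R) : z0 - t <= z <= z0 + t -> `|z - z0| <= delta.
  by move=> /andP[? ?]; rewrite ler_norml; apply/andP; split; lra.
have le (z0 : R) : z0 - t <= z0 + t by lra.
have xt (z0 : R) : z0 - t <= z0 - t <= z0 + t by rewrite lexx le.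
have xt' (z0 : R) : z0 - t <= z0 + t <= z0 + t by rewrite lexx le.
have IP y : y0 - t <= y <= y0 + t ->
    `|\int[@lebesgue_measure R]_(x in `[x0 - t, x0 + t]) P x y| <= M * (2 * t).
  move=> /near yn; have -> : 2 * t = x0 + t - (x0 - t) by ring.
  by apply: Rintegral_segment_norm_le => // x /near xn; have [] := bd x y xn yn.
have IQ x : x0 - t <= x <= x0 + t ->
    `|\int[@lebesgue_measure R]_(y in `[y0 - t, y0 + t]) Q x y| <= M * (2 * t).
  move=> /near xn; have -> : 2 * t = y0 + t - (y0 - t) by ring.
  by apply: Rintegral_segment_norm_le => // y /near yn; have [] := bd x y xn yn.
have B : M * (2 * t) + M * (2 * t) + (M * (2 * t) + M * (2 * t)) <= eta.
  move: teta; rewrite ler_pdivlMr; last by lra.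
  by apply: le_trans; nra.
rewrite (le_trans _ B)// /rectangle_circulation.
rewrite (le_trans (ler_normD _ _))// lerD//.
  by rewrite (le_trans (ler_normB _ _))// lerD ?IP.
by rewrite (le_trans (ler_normB _ _))// lerD ?IQ.
Qed.

End punctured_goursat.

(** * Complex functions along coordinate lines and the Cauchy-Riemann equations *)

Section complex_to_real.
Context {R : realType}.
Local Open Scope complex_scope.
Implicit Types (f : R[i] -> R[i]) (z w : R[i]).

Definition ccontinuous f := forall z (eps : R), 0 < eps ->
  exists2 delta : R, 0 < delta &
    forall w, normc (w - z) < delta -> normc (f w - f z) < eps.

Lemma ccontinuous_entire f : entire f -> ccontinuous f.
Proof. by move=> ef z; exact: C_differentiable_at_cont. Qed.

Lemma ler_dist_normc z w : `|normc z - normc w| <= normc (z - w).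
Proof.
have H u v : normc u - normc v <= normc (u - v).
  by rewrite lerBlDr (le_trans _ (le_normcD _ _))// subrK.
by rewrite ler_norml H andbT lerNl opprB normcB H.
Qed.

Section slices.
Variables (phi : R[i] -> R) (f : R[i] -> R[i]).
Hypothesis phi_lip : forall z w, `|phi z - phi w| <= normc (z - w).
Hypothesis cf : ccontinuous f.

(** A general 1-Lipschitz [phi] covers [Re], [Im] and [normc] at once. *)
Lemma continuous_slicex (y : R) : continuous (fun x => phi (f (x +i* y))).
Proof.
move=> x; apply/cvgrPdist_lt => e e0; have [de de0 H] := cf (x +i* y) e0.
exists de => // x' /= xx; rewrite distrC (le_lt_trans (phi_lip _ _))// H//.
by rewrite (le_lt_trans (normc_le_add _))//= subrr normr0 addr0 distrC.
Qed.

Lemma continuous_slicey (x : R) : continuous (fun y => phi (f (x +i* y))).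
Proof.
move=> y; apply/cvgrPdist_lt => e e0; have [de de0 H] := cf (x +i* y) e0.
exists de => // y' /= yy; rewrite distrC (le_lt_trans (phi_lip _ _))// H//.
by rewrite (le_lt_trans (normc_le_add _))//= subrr normr0 add0r distrC.
Qed.

End slices.

Lemma Re_lip z w : `|Re z - Re w| <= normc (z - w).
Proof. by have := normr_Re_le (z - w); case: z w => [? ?] [? ?]. Qed.

Lemma Im_lip z w : `|Im z - Im w| <= normc (z - w).
Proof. by have := normr_Im_le (z - w); case: z w => [? ?] [? ?]. Qed.

(* Im (f dz) = (Im f) dx + (Re f) dy, whose closedness is the Cauchy-Riemann
   equation d(Im f)/dy = d(Re f)/dx. *)
Lemma closed_form_Im_dz f (x y : R) : C_differentiable_at f (x +i* y) ->
  closed_form_at (fun x y => Im (f (x +i* y))) (fun x y => Re (f (x +i* y))) x y.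
Proof.
move=> /C_differentiable_at_approx[[d1 d2] H]; exists d2, d1, (- d2) => e e0.
have [de de0 {}H] := H _ e0; exists (de / 2); first by rewrite divr_gt0.
move=> x' y' xx yy; have := H (x' +i* y').
set w := (x' +i* y'); set z := (x +i* y).
have nwz : normc (w - z) <= `|x' - x| + `|y' - y| by exact: normc_le_add.
have -> : normc (w - z) < de by apply: le_lt_trans nwz _; lra.
move=> /(_ isT) A.
have {}A : normc (f w - f z - (d1 +i* d2) * (w - z)) <=
    e * (`|x' - x| + `|y' - y|).
  by apply: le_trans A _; rewrite ler_wpM2l// ltW.
split.
- apply: le_trans A; apply: le_trans (normr_Im_le _).
  rewrite /w /z; case: (f _) => f1 f2; case: (f _) => f3 f4 /=.
  by rewrite le_eqVlt; apply/orP; left; apply/eqP; congr (`|_|); ring.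
- apply: le_trans A; apply: le_trans (normr_Re_le _).
  rewrite /w /z; case: (f _) => f1 f2; case: (f _) => f3 f4 /=.
  by rewrite le_eqVlt; apply/orP; left; apply/eqP; congr (`|_|); ring.
Qed.

End complex_to_real.

(** * The Cauchy quotient and boundary means *)

Section cauchy_quotient.
Context {R : realType}.
Local Open Scope complex_scope.
Implicit Types (g : R[i] -> R[i]) (z w : R[i]).
Variables (g : R[i] -> R[i]) (z0 : R[i]).
Hypothesis eg : entire g.

(** The singularity at [z0] is removed by inserting the derivative. The factor conj(g(z0)) makes the
    subtracted constant equal to the real number |g(z0)|^2, whose contribution has a definite sign
    on each side of a rectangle around [z0]. *)
Lemma cauchy_quotient : exists H : R[i] -> R[i],
  [/\ forall z, z != z0 -> H z = (g z0)^* * (g z - g z0) / (z - z0),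
      ccontinuous H & forall z, z != z0 -> C_differentiable_at H z].
Proof.
set a := g z0; have [d dP] := eg z0.
pose h z := a^* * (g z - a) / (z - z0).
pose H z := if z == z0 then a^* * d else h z.
have Hh z : z != z0 -> H z = h z by rewrite /H => /negbTE ->.
have dh z : z != z0 -> C_differentiable_at h z.
  move=> zz; apply: (@C_differentiable_atM _ (fun z => a^* * (g z - a))
    (fun z => (z - z0)^-1)).
    apply: (@C_differentiable_atM _ (fun=> a^*)); first exact: entire_cst.
    exact/C_differentiable_at_sub_cst.
  apply: (@C_differentiable_at_inv _ (fun z => z - z0)).
    by rewrite subr_eq0.
  by apply: C_differentiable_at_sub_cst; exact: entire_id.
have dH z : z != z0 -> C_differentiable_at H z.
  move=> zz; have [e eP] := dh _ zz; exists e => eps eps0.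
  have [de de0 Hde] := eP _ eps0.
  have nz : 0 < normc (z0 - z) by rewrite normc_gt0// subr_eq0 eq_sym.
  exists (Num.min de (normc (z0 - z))); first by rewrite lt_min de0.
  move=> k k0; rewrite lt_min => /andP[kde knz].
  rewrite !Hh//; first exact: Hde.
  apply/eqP => zk; move: knz; rewrite -zk (addrC z) addrK.
  by rewrite ltxx.
exists H; split => // z eps eps0.
have [->|zz] := eqVneq z z0; last exact: C_differentiable_at_cont (dH _ zz) _ eps0.
have a0 := normc_ge0 a^*.
(* The [+ 1] keeps the denominator positive when [g z0 = 0]. *)
have [|de de0 Hde] := dP (eps / (normc a^* + 1)).
  by rewrite divr_gt0// ltr_wpDl.
exists de => // w wde; have [->|wz] := eqVneq w z0.
  by rewrite subrr normc0.
have wz0 : w - z0 != 0 by rewrite subr_eq0.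
have := Hde _ wz0 wde; rewrite (addrC z0) subrK -/a => W.
rewrite Hh// /H eqxx /h -mulrA -mulrBr normcM.
have [a0'|an0] := eqVneq (normc a^*) 0; first by rewrite a0' mul0r.
have {}a0 : 0 < normc a^* by rewrite lt_neqAle eq_sym an0.
move: W; rewrite ltr_pdivlMr ?ltr_wpDl//; last exact: ltW.
apply: le_lt_trans; rewrite mulrC ler_wpM2l ?normc_ge0//.
by rewrite lerDl.
Qed.

End cauchy_quotient.

Section boundary_mean.
Context {R : realType}.
Local Open Scope complex_scope.
Local Notation mu := (@lebesgue_measure R).

(** Here [zeta] is the displacement from the centre and [e] the unit tangent. Since e / zeta = e
    conj(zeta) / |zeta|^2, its imaginary part is at least (d / 2) / (2 d^2) = 1 / (4 d), while
    |zeta| >= d / 2 controls the term with [b]. *)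
Lemma Im_quotient_le (a b e zeta : R[i]) (d : R) : 0 < d -> normc e = 1 ->
  d / 2 <= Im (e * zeta^*) -> normc zeta ^+ 2 <= 2 * d ^+ 2 ->
  Im (e * (a^* * (b - a) / zeta)) <=
    2 * normc a / d * normc b - normc a ^+ 2 / (4 * d).
Proof.
move=> d0 e1 ez zd.
have nz : d / 2 <= normc zeta.
  rewrite (le_trans ez)// (le_trans (ler_norm _))// (le_trans (normr_Im_le _))//.
  by rewrite normcM e1 mul1r; case: (zeta) => u v /=; rewrite sqrrN.
have nz0 : 0 < normc zeta by apply: lt_le_trans nz; rewrite divr_gt0.
have z0 : zeta != 0 by apply/eqP => z0; rewrite z0 normc0 ltxx in nz0.
have aa : a^* * a = (normc a ^+ 2)%:C.
  case: (a) => u v /=; rewrite sqr_sqrtr ?addr_ge0 ?sqr_ge0//.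
  by apply/eqP; rewrite eq_complex /=; apply/andP; split; apply/eqP; ring.
have ev : e / zeta = (normc zeta ^- 2)%:C * (e * zeta^*).
  rewrite invc_norm mulrCA; congr (_ * _).
  by rewrite -[`|zeta|]/((normc zeta)%:C) -rmorphXn/= -fmorphV.
have -> : e * (a^* * (b - a) / zeta) =
    e * (a^* * b / zeta) - (normc a ^+ 2)%:C * (e / zeta).
  by rewrite -aa; ring.
have ImB (u v : R[i]) : Im (u - v) = Im u - Im v by case: u v => [? ?] [? ?].
have ImZ (r : R) (u : R[i]) : Im (r%:C * u) = r * Im u.
  by case: u => ? ? /=; rewrite mul0r addr0.
rewrite ImB ImZ ev ImZ; apply: lerB.
  rewrite (le_trans (ler_norm _))// (le_trans (normr_Im_le _))//.
  rewrite !normcM e1 mul1r normcV.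
  have -> : normc a^* = normc a by case: (a) => u v /=; rewrite sqrrN.
  have -> : 2 * normc a / d * normc b = normc a * normc b * (d / 2)^-1.
    by field; rewrite gt_eqF.
  by rewrite ler_wpM2l ?mulr_ge0 ?normc_ge0// lef_pV2// posrE ?divr_gt0.
rewrite ler_wpM2l ?sqr_ge0//.
have -> : (4 * d)^-1 = (2 * d ^+ 2)^-1 * (d / 2) by field; rewrite gt_eqF.
apply: ler_pM => //.
- by rewrite invr_ge0 mulr_ge0 ?sqr_ge0.
- by rewrite divr_ge0// ltW.
- by rewrite lef_pV2// posrE ?mulr_gt0 ?exprn_gt0.
Qed.

(** The circulation of Im (H dz) vanishes by the punctured Goursat theorem. With c = |g(z0)|, every
    side has length at least [d], so its negative term is at least c^2 / 4 in size; the four sides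
    give c^2 <= (2 c / d) times the sum of the boundary integrals, and one factor c cancels. *)
Lemma boundary_mean (g : R[i] -> R[i]) (x0 y0 d u1 u2 v1 v2 : R) :
  entire g -> 0 < d ->
  d / 2 <= u1 - x0 <= d -> d / 2 <= x0 - u2 <= d ->
  d / 2 <= v1 - y0 <= d -> d / 2 <= y0 - v2 <= d ->
  d * normc (g (x0 +i* y0)) <= 2 *
    (\int[mu]_(x in `[u2, u1]) normc (g (x +i* v2)) +
     \int[mu]_(x in `[u2, u1]) normc (g (x +i* v1)) +
     (\int[mu]_(y in `[v2, v1]) normc (g (u1 +i* y)) +
      \int[mu]_(y in `[v2, v1]) normc (g (u2 +i* y)))).
Proof.
move=> eg d0 /andP[u1a u1b] /andP[u2a u2b] /andP[v1a v1b] /andP[v2a v2b].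
set z0 := x0 +i* y0.
have cg := ccontinuous_entire eg.
have ngx y : continuous (fun x => normc (g (x +i* y))).
  exact: (continuous_slicex ler_dist_normc cg).
have ngy x : continuous (fun y => normc (g (x +i* y))).
  exact: (continuous_slicey ler_dist_normc cg).
have [H [Hh cH dH]] := cauchy_quotient z0 eg.
set c := normc (g z0).
have c0 : 0 <= c by exact: normc_ge0.
have cP y : continuous (fun x => Im (H (x +i* y))).
  exact: (continuous_slicex Im_lip cH).
have cQ x : continuous (fun y => Re (H (x +i* y))).
  exact: (continuous_slicey Re_lip cH).
have circ0 : rectangle_circulation (fun x y => Im (H (x +i* y)))
    (fun x y => Re (H (x +i* y))) u2 u1 v2 v1 = 0.
  have [de de0 Hde] := cH z0 1 ltr01.
  apply: (@goursat_punctured_rectangle _ _ _ cP cQ _ _ _ _ x0 y0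
    (1 + normc (H z0)) (de / 3)).
  - by apply/andP; split; lra.
  - by apply/andP; split; lra.
  - move=> x y xy; apply: closed_form_Im_dz; apply: dH.
    by apply: contra xy => /eqP[-> ->].
  - by rewrite divr_gt0.
  - move=> x y xd yd; have N : normc (H (x +i* y)) <= 1 + normc (H z0).
      rewrite -lerBlDr; apply: le_trans (ltW (Hde (x +i* y) _)).
        exact: le_trans (ler_norm _) (ler_dist_normc _ _).
      by rewrite (le_lt_trans (normc_le_add _))//=; lra.
    by split; apply: le_trans N; [exact: normr_Im_le|exact: normr_Re_le].
(* Used with [e] equal to [1], [-1], ['i] and [- 'i], the counterclockwise tangents of the bottom,
   top, right and left sides. *)
have side (e : R[i]) (x y : R) : normc e = 1 ->
    d / 2 <= Im (e * ((x +i* y) - z0)^*) -> u2 <= x <= u1 -> v2 <= y <= v1 ->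
    Im (e * H (x +i* y)) <=
      2 * c / d * normc (g (x +i* y)) - c ^+ 2 / (4 * d).
  move=> e1 ez /andP[xa xb] /andP[ya yb]; rewrite Hh.
    apply: Im_quotient_le => //=.
    rewrite sqr_sqrtr ?addr_ge0 ?sqr_ge0//.
    have xx : `|x - x0| <= d by rewrite ler_norml; apply/andP; split; lra.
    have yy : `|y - y0| <= d by rewrite ler_norml; apply/andP; split; lra.
    rewrite mulr_natl mulr2n lerD// -real_normK ?num_real//.
      by rewrite lerXn2r ?nnegrE// ltW.
    by rewrite lerXn2r ?nnegrE// ltW.
  apply/eqP => zz; move: ez; rewrite zz subrr; case: (e) => e' e'' /=; lra.
have uu : u2 <= u1 by lra.
have vv : v2 <= v1 by lra.
have ni1 : normc (1 : R[i]) = 1 by rewrite normc1.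
have nii : normc ('i : R[i]) = 1 by rewrite /= expr0n/= add0r expr1n sqrtr1.
have niN1 : normc (-1 : R[i]) = 1 by rewrite normcN.
have niNi : normc (- 'i : R[i]) = 1 by rewrite normcN.
have B1 : 1 * \int[mu]_(x in `[u2, u1]) Im (H (x +i* v2)) <=
    2 * c / d * \int[mu]_(x in `[u2, u1]) normc (g (x +i* v2)) -
    c ^+ 2 / (4 * d) * (u1 - u2).
  apply: Rintegral_segment_scale_le => // t tu.
  have := @side 1 t v2; rewrite !mul1r; apply => //; [by rewrite /=; lra|by rewrite lexx vv].
have B2 : -1 * \int[mu]_(x in `[u2, u1]) Im (H (x +i* v1)) <=
    2 * c / d * \int[mu]_(x in `[u2, u1]) normc (g (x +i* v1)) -
    c ^+ 2 / (4 * d) * (u1 - u2).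
  apply: Rintegral_segment_scale_le => // t tu.
  have := @side (-1) t v1; rewrite !mulN1r.
  have -> : Im (- H (t +i* v1)) = - Im (H (t +i* v1)) by case: (H _).
  apply => //; [by rewrite /=; lra|by rewrite lexx vv].
have B3 : 1 * \int[mu]_(y in `[v2, v1]) Re (H (u1 +i* y)) <=
    2 * c / d * \int[mu]_(y in `[v2, v1]) normc (g (u1 +i* y)) -
    c ^+ 2 / (4 * d) * (v1 - v2).
  apply: Rintegral_segment_scale_le => // t tv.
  have := @side 'i u1 t; rewrite mul1r.
  have -> : Im ('i * H (u1 +i* t)) = Re (H (u1 +i* t)).
    by case: (H _) => ? ? /=; ring.
  apply => //; [by rewrite /=; lra|by rewrite lexx uu].
have B4 : -1 * \int[mu]_(y in `[v2, v1]) Re (H (u2 +i* y)) <=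
    2 * c / d * \int[mu]_(y in `[v2, v1]) normc (g (u2 +i* y)) -
    c ^+ 2 / (4 * d) * (v1 - v2).
  apply: Rintegral_segment_scale_le => // t tv.
  have := @side (- 'i) u2 t; rewrite mulN1r.
  have -> : Im (- 'i * H (u2 +i* t)) = - Re (H (u2 +i* t)).
    by case: (H _) => ? ? /=; ring.
  apply => //; [by rewrite /=; lra|by rewrite lexx uu].
have n0 (D : set R) (h : R -> R[i]) : 0 <= \int[mu]_(t in D) normc (h t).
  by apply: Rintegral_ge0 => t _; exact: normc_ge0.
have := (n0 `[u2, u1]%classic (fun x => g (x +i* v2)), n0 `[u2, u1]%classic (fun x => g (x +i* v1)),
  n0 `[v2, v1]%classic (fun y => g (u1 +i* y)), n0 `[v2, v1]%classic (fun y => g (u2 +i* y))).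
move: circ0 B1 B2 B3 B4; rewrite /rectangle_circulation.
move: (\int[mu]_(x in _) normc _) (\int[mu]_(x in _) normc _) => G1 G2.
move: (\int[mu]_(x in _) normc _) (\int[mu]_(x in _) normc _) => G3 G4.
move: (Rintegral _ _ _) (Rintegral _ _ _) => I1 I2.
move: (Rintegral _ _ _) (Rintegral _ _ _) => I3 I4.
move=> C B1 B2 B3 B4 [[[G10 G20] G30] G40].
have k0 : 0 <= c ^+ 2 / (4 * d) by rewrite divr_ge0 ?sqr_ge0// mulr_ge0// ltW.
have L : c ^+ 2 / (4 * d) * d <= c ^+ 2 / (4 * d) * (u1 - u2).
  by rewrite ler_wpM2l//; lra.
have L' : c ^+ 2 / (4 * d) * d <= c ^+ 2 / (4 * d) * (v1 - v2).
  by rewrite ler_wpM2l//; lra.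
have cd : c ^+ 2 / (4 * d) * d = c ^+ 2 / 4 by field; rewrite gt_eqF.
have F : c ^+ 2 <= 2 * c / d * (G1 + G2 + (G3 + G4)) by lra.
have G0 : 0 <= G1 + G2 + (G3 + G4) by rewrite !addr_ge0.
have [->|cn0] := eqVneq c 0; first by rewrite mulr0; lra.
have {}c0 : 0 < c by rewrite lt_neqAle eq_sym cn0.
rewrite -(ler_pM2l c0); move: F; rewrite mulrAC ler_pdivlMr//.
by congr (_ <= _); ring.
Qed.

End boundary_mean.

(** * Measurability and Tonelli's theorem in the plane *)

Section plane_measurability.
Context {R : realType}.

Definition jcontinuous (k : R * R -> R) := forall q (eps : R), 0 < eps ->
  exists2 delta : R, 0 < delta & forall q', `|q'.1 - q.1| < delta ->
    `|q'.2 - q.2| < delta -> `|k q' - k q| < eps.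

(** The sets where [k] exceeds [a] are countable unions of open boxes with rational centres and
    sides [2 / n.+1], and boxes are measurable for the product sigma-algebra. Boxes not contained in
    the set are replaced by [set0]. *)
Lemma jcontinuous_measurable (k : R * R -> R) :
  jcontinuous k -> measurable_fun [set: R * R] k.
Proof.
move=> ck; apply: (measurability _ (RGenOInfty.measurableE R)).
move=> _ [_ [a ->] <-]; rewrite setTI; set U := (X in measurable X).
pose box (i : rat * rat * nat) : set (R * R) :=
  `](ratr i.1.1 - i.2.+1%:R^-1), (ratr i.1.1 + i.2.+1%:R^-1)[%classic `*`
  `](ratr i.1.2 - i.2.+1%:R^-1), (ratr i.1.2 + i.2.+1%:R^-1)[%classic.
pose B i := if pselect (box i `<=` U) then box i else set0.
have -> : U = \bigcup_i B i.
  apply/seteqP; split => [q Uq|q [i _]]; last first.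
    by rewrite /B; case: pselect => // H; exact: H.
  have kq : 0 < k q - a.
    by move: Uq; rewrite /U /= in_itv/= andbT subr_gt0.
  have [de de0 H] := ck q _ kq.
  have [|n hn] := @ltr_add_invr _ 0 (de / 2); first by rewrite divr_gt0.
  rewrite add0r in hn; set r : R := n.+1%:R^-1 in hn.
  have r0 : 0 < r by rewrite invr_gt0.
  have rat_near (x : R) : exists s : rat, x - r < ratr s < x + r.
    have [|s] := @rat_in_itvoo _ (x - r) (x + r); first by lra.
    by rewrite in_itv/= => ?; exists s.
  have [s1 /andP[s1a s1b]] := rat_near q.1.
  have [s2 /andP[s2a s2b]] := rat_near q.2.
  exists (s1, s2, n) => //; rewrite /B; case: pselect => /=.
    by move=> _; split; rewrite /= in_itv/= -/r; apply/andP; split; lra.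
  apply; move=> q' [] /=; rewrite !in_itv/= -/r => /andP[x1 x2] /andP[y1 y2].
  rewrite /U /= in_itv/= andbT.
  have : `|k q' - k q| < k q - a.
    by apply: H; rewrite ltr_norml; apply/andP; split; lra.
  by rewrite ltr_norml => /andP[? _]; lra.
apply: countable_bigcupT_measurable; first exact: countableP.
move=> i; rewrite /B; case: pselect => [?|?] //=.
by apply: measurableX; exact: measurable_itv.
Qed.

Lemma jcontinuous_continuous (k : R * R -> R) : jcontinuous k -> continuous k.
Proof.
move=> ck q; apply/cvgrPdist_lt => e e0; have [de de0 H] := ck q _ e0.
exists (ball q.1 de, ball q.2 de) => /=.
  by split; exact: nbhsx_ballx.
move=> q' [/= q1 q2].
by rewrite distrC; apply: H; rewrite distrC.
Qed.

End plane_measurability.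

Lemma measurable_restrict_ereal d (T : measurableType d) (R : realType)
    (D : set T) (f : T -> \bar R) : measurable D -> measurable_fun [set: T] f ->
  measurable_fun [set: T] (f \_ D).
Proof.
move=> mD mf; apply/(measurable_restrictT _ mD).1; exact: measurable_funTS.
Qed.

Section tonelli_rectangle.
Local Open Scope ereal_scope.
Context d1 d2 (T1 : measurableType d1) (T2 : measurableType d2) (R : realType).
Variables (m1 : {sigma_finite_measure set T1 -> \bar R})
          (m2 : {sigma_finite_measure set T2 -> \bar R}).
Variables (A : set T1) (B : set T2) (f : T1 * T2 -> \bar R).
Hypotheses (mA : measurable A) (mB : measurable B).
Hypothesis mf : measurable_fun [set: T1 * T2] f.
Hypothesis f0 : forall q, 0 <= f q.

Let mfAB : measurable_fun [set: T1 * T2] (f \_ (A `*` B)).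
Proof.
by apply: measurable_restrict_ereal => //; exact: measurableX.
Qed.

Let fAB0 q : 0 <= (f \_ (A `*` B)) q.
Proof. by apply: erestrict_ge0. Qed.

Lemma tonelli_setX1 : \int[m1 \x m2]_(q in A `*` B) f q =
  \int[m1]_(x in A) \int[m2]_(y in B) f (x, y).
Proof.
rewrite integral_mkcond fubini_tonelli1// [RHS]integral_mkcond.
apply: eq_integral => x _; rewrite /fubini_F patchE; case: ifPn => xA.
  rewrite [RHS]integral_mkcond; apply: eq_integral => y _.
  by rewrite !patchE in_setX xA.
by apply: integral0_eq => y _; rewrite patchE in_setX (negbTE xA).
Qed.

Lemma tonelli_setX2 : \int[m1 \x m2]_(q in A `*` B) f q =
  \int[m2]_(y in B) \int[m1]_(x in A) f (x, y).
Proof.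
rewrite integral_mkcond fubini_tonelli2// [RHS]integral_mkcond.
apply: eq_integral => y _; rewrite /fubini_G patchE; case: ifPn => yB.
  rewrite [RHS]integral_mkcond; apply: eq_integral => x _.
  by rewrite !patchE in_setX yB andbT.
by apply: integral0_eq => x _; rewrite patchE in_setX (negbTE yB) andbF.
Qed.

End tonelli_rectangle.

Section slice_integral_measurability.
Local Open Scope ereal_scope.
Context d1 d2 (T1 : measurableType d1) (T2 : measurableType d2) (R : realType).
Variables (m1 : {sigma_finite_measure set T1 -> \bar R})
          (m2 : {sigma_finite_measure set T2 -> \bar R}).
Variable f : T1 * T2 -> \bar R.
Hypothesis mf : measurable_fun [set: T1 * T2] f.
Hypothesis f0 : forall q, 0 <= f q.

Lemma measurable_slice_integral1 (B : set T2) : measurable B ->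
  measurable_fun setT (fun x => \int[m2]_(y in B) f (x, y)).
Proof.
move=> mB; have := @measurable_fun_fubini_tonelli_F _ _ T1 T2 R m2
  (f \_ (setT `*` B)).
rewrite (_ : fubini_F _ _ = fun x => \int[m2]_(y in B) f (x, y)).
  apply; last by move=> q; apply: erestrict_ge0.
  by apply: measurable_restrict_ereal => //; exact: measurableX.
apply/funext => x; rewrite /fubini_F [RHS]integral_mkcond.
by apply: eq_integral => y _; rewrite !patchE in_setX in_setT.
Qed.

Lemma measurable_slice_integral2 (A : set T1) : measurable A ->
  measurable_fun setT (fun y => \int[m1]_(x in A) f (x, y)).
Proof.
move=> mA; have := @measurable_fun_fubini_tonelli_G _ _ T1 T2 R m1
  (f \_ (A `*` setT)).
rewrite (_ : fubini_G _ _ = fun y => \int[m1]_(x in A) f (x, y)).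
  apply; last by move=> q; apply: erestrict_ge0.
  by apply: measurable_restrict_ereal => //; exact: measurableX.
apply/funext => x; rewrite /fubini_G [RHS]integral_mkcond.
by apply: eq_integral => y _; rewrite !patchE in_setX in_setT andbT.
Qed.

End slice_integral_measurability.

(** The bound on [F] is integrated over [A], the order of integration is exchanged, and the inner
    integral over [A] is then bounded by [G]. In the application [t] is an angle and [q] a point of
    the plane. *)
Lemma tonelli_domination d1 d2 (T1 : measurableType d1) (T2 : measurableType d2)
    (R : realType) (m1 : {sigma_finite_measure set T1 -> \bar R})
    (m2 : {sigma_finite_measure set T2 -> \bar R}) (A : set T1)
    (H : T1 * T2 -> \bar R) (F : T1 -> \bar R) (G : T2 -> \bar R) (C : R) :
  measurable A -> measurable_fun [set: T1 * T2] H -> (forall q, 0 <= H q)%E ->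
  measurable_fun [set: T1] F -> (forall t, 0 <= F t)%E ->
  measurable_fun [set: T2] G -> 0 <= C ->
  (forall t, F t <= C%:E * \int[m2]_q H (t, q))%E ->
  (forall q, \int[m1]_(t in A) H (t, q) <= G q)%E ->
  (\int[m1]_(t in A) F t <= C%:E * \int[m2]_q G q)%E.
Proof.
move=> mA mH H0 mF F0 mG C0 FH HG.
have mI1 := measurable_slice_integral1 m2 mH H0 measurableT.
have mI2 := measurable_slice_integral2 m1 mH H0 mA.
apply: (@le_trans _ _ (C%:E * \int[m1]_(t in A) \int[m2]_q H (t, q))%E).
  rewrite -ge0_integralZl_EFin//; last 2 first.
  - by move=> t _; exact: integral_ge0.
  - exact: measurable_funTS mI1.
  apply: ge0_le_integral => //.
  - exact: measurable_funTS.
  - by apply: measurable_funeM; exact: measurable_funTS mI1.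
apply: lee_wpmul2l; first by rewrite lee_fin.
rewrite -tonelli_setX1// tonelli_setX2//; apply: ge0_le_integral => //.
by move=> q _; exact: integral_ge0.
Qed.

(** Averaging: if [F] were at least [M] on all of [A], its integral would be at least [M * v]. *)
Lemma integral_lt_exists d (T : measurableType d) (R : realType)
    (m : {measure set T -> \bar R}) (A : set T) (F : T -> \bar R) (M v : R) :
  measurable A -> m A = v%:E -> 0 <= M ->
  measurable_fun A F -> (\int[m]_(x in A) F x < (M * v)%:E)%E ->
  exists2 x, A x & (F x < M%:E)%E.
Proof.
move=> mA mAv M0 mF; apply: contraPP => N; apply/negP; rewrite -leNgt.
rewrite EFinM -mAv -integral_cst//; apply: ge0_le_integral => //.
move=> x Ax; rewrite leNgt; apply/negP => FM; apply: N.
by exists x.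
Qed.

(** * Mean value estimates over squares *)

Section square_mean.
Context {R : realType}.
Local Open Scope complex_scope.
Local Notation mu := (@lebesgue_measure R).
Local Notation mu2 := (mu \x mu)%E.

Definition square (x0 y0 d : R) : set (R * R) :=
  `[x0 - d, x0 + d]%classic `*` `[y0 - d, y0 + d]%classic.

Lemma squareE x0 y0 d q :
  square x0 y0 d q <-> `|q.1 - x0| <= d /\ `|q.2 - y0| <= d.
Proof. by rewrite /square /= !in_itv/= !ler_distl. Qed.

Lemma measurable_square x0 y0 d : measurable (square x0 y0 d).
Proof. by apply: measurableX; exact: measurable_itv. Qed.

Lemma square_area x0 y0 d : 0 <= d ->
  mu2 (square x0 y0 d) = (4 * d ^+ 2)%:E.
Proof.
move=> d0; rewrite product_measure1E; [|exact: measurable_itv..].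
by rewrite /= !lebesgue_measure_segment ?lerD2l ?ge0_cp// -?EFinM;
  [congr EFin; ring|lra..].
Qed.

Section jcontinuous_comp.
Variables (phi : R[i] -> R) (f : R[i] -> R[i]).
Hypothesis phi_lip : forall z w, `|phi z - phi w| <= normc (z - w).
Hypothesis cf : ccontinuous f.

Lemma jcontinuous_complex : jcontinuous (fun q => phi (f (q.1 +i* q.2))).
Proof.
move=> q e e0; have [de de0 H] := cf (q.1 +i* q.2) e0.
exists (de / 2); first by rewrite divr_gt0.
move=> q' q1 q2; rewrite (le_lt_trans (phi_lip _ _))// H//.
by rewrite (le_lt_trans (normc_le_add _))//=; lra.
Qed.

End jcontinuous_comp.

Lemma measurable_normc_entire g : entire g ->
  measurable_fun [set: R * R] (fun q => normc (g (q.1 +i* q.2))).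
Proof.
move=> /ccontinuous_entire cg; apply: jcontinuous_measurable.
exact: jcontinuous_complex ler_dist_normc cg.
Qed.

(** By contradiction: if the integral over the square were too small, averaging would produce two
    vertical and two horizontal lines, at distances between [d / 2] and [d] from the centre, on
    which the integral of |g| is below [c * d / 8]. Summing the four sides contradicts
    [boundary_mean]. *)
Lemma square_mean g (x0 y0 d : R) : entire g -> 0 < d ->
  ((normc (g (x0 +i* y0)) * d ^+ 2)%:E <=
   16%:E * \int[mu2]_(q in square x0 y0 d) (normc (g (q.1 +i* q.2)))%:E)%E.
Proof.
move=> eg d0; set c := normc _.
have cg := ccontinuous_entire eg.
have ngx y : continuous (fun x => normc (g (x +i* y))).
  exact: (continuous_slicex ler_dist_normc cg).
have ngy x : continuous (fun y => normc (g (x +i* y))).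
  exact: (continuous_slicey ler_dist_normc cg).
pose k (q : R * R) : \bar R := (normc (g (q.1 +i* q.2)))%:E.
have k0 q : (0 <= k q)%E by rewrite lee_fin normc_ge0.
have mk : measurable_fun [set: R * R] k.
  by apply/measurable_EFinP; exact: measurable_normc_entire.
have [c0|cn0] := eqVneq c 0.
  by rewrite c0 mul0r mule_ge0// ?lee_fin//; apply: integral_ge0 => q _; exact: k0.
have {cn0} c0 : 0 < c by rewrite lt_neqAle eq_sym cn0 normc_ge0.
rewrite leNgt; apply/negP; rewrite -lte_pdivlMl// -EFinM => small.
set I := `[x0 - d, x0 + d]%classic; set J := `[y0 - d, y0 + d]%classic.
have cd : 0 <= c * d / 8 by rewrite divr_ge0// mulr_ge0// ltW.
have subI (a b l r : R) : l <= a -> b <= r -> `[a, b] `<=` `[l, r].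
  by move=> la br t /=; rewrite !in_itv/= => /andP[? ?]; apply/andP; split; lra.
(* The line is sought in an interval of length [d / 2], and [c * d / 8 * (d / 2)] is the assumed
   bound [c * d ^+ 2 / 16]. *)
have pick (F : R -> \bar R) (l r a : R) : measurable_fun setT F ->
    (forall x, 0 <= F x)%E -> l <= a -> a + d / 2 <= r ->
    (\int[mu]_(x in `[l, r]) F x < (16^-1 * (c * d ^+ 2))%:E)%E ->
    exists2 u, a <= u <= a + d / 2 & (F u < (c * d / 8)%:E)%E.
  move=> mF F0 la ar iF.
  have [|||||u] := @integral_lt_exists _ _ R mu `[a, a + d / 2]%classic F
    (c * d / 8) (d / 2).
  - exact: measurable_itv.
  - transitivity (a + d / 2 - a)%:E; last by congr EFin; ring.
    by apply: lebesgue_measure_segment; lra.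
  - exact: cd.
  - exact: measurable_funTS.
  - have -> : c * d / 8 * (d / 2) = 16^-1 * (c * d ^+ 2) by field.
    apply: le_lt_trans iF; apply: ge0_subset_integral => //.
    + exact: measurable_funTS.
    + exact: subI.
  - by rewrite /= in_itv/=; exists u.
have iJ : (\int[mu]_(x in I) \int[mu]_(y in J) k (x, y) <
    (16^-1 * (c * d ^+ 2))%:E)%E.
  by rewrite -tonelli_setX1//; exact: measurable_itv.
have iI : (\int[mu]_(y in J) \int[mu]_(x in I) k (x, y) <
    (16^-1 * (c * d ^+ 2))%:E)%E.
  by rewrite -tonelli_setX2//; exact: measurable_itv.
have mF : measurable_fun setT (fun x => (\int[mu]_(y in J) k (x, y))%E).
  by apply: measurable_slice_integral1 => //; exact: measurable_itv.
have mG : measurable_fun setT (fun y => (\int[mu]_(x in I) k (x, y))%E).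
  by apply: measurable_slice_integral2 => //; exact: measurable_itv.
have F0 x : (0 <= \int[mu]_(y in J) k (x, y))%E by exact: integral_ge0.
have G0 y : (0 <= \int[mu]_(x in I) k (x, y))%E by exact: integral_ge0.
have [||u1 /andP[? ?] U1] := pick _ _ _ (x0 + d / 2) mF F0 _ _ iJ; [lra|lra|].
have [||u2 /andP[? ?] U2] := pick _ _ _ (x0 - d) mF F0 _ _ iJ; [lra|lra|].
have [||v1 /andP[? ?] V1] := pick _ _ _ (y0 + d / 2) mG G0 _ _ iI; [lra|lra|].
have [||v2 /andP[? ?] V2] := pick _ _ _ (y0 - d) mG G0 _ _ iI; [lra|lra|].
(* Passes from the full slice of the square to the shorter side of the chosen rectangle, and from
   extended to real integrals. *)
have Rlt (h : R -> R) (l r a b : R) : continuous h -> (forall t, 0 <= h t) ->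
    l <= a -> b <= r -> (\int[mu]_(t in `[l, r]) (h t)%:E < (c * d / 8)%:E)%E ->
    \int[mu]_(t in `[a, b]) h t < c * d / 8.
  move=> ch h0 la br hlt; rewrite -lte_fin /Rintegral fineK; last first.
    by apply: integrable_fin_num => //; exact: continuous_integrable_segment.
  apply: le_lt_trans hlt; apply: ge0_subset_integral => //.
  - apply/measurable_EFinP; apply: measurable_funTS.
    exact: continuous_measurable_fun.
  - by move=> t _; rewrite lee_fin.
  - exact: subI.
have BM := @boundary_mean _ g x0 y0 d u1 u2 v1 v2 eg d0
  ltac:(apply/andP; split; lra) ltac:(apply/andP; split; lra)
  ltac:(apply/andP; split; lra) ltac:(apply/andP; split; lra).
suff : d * c < d * c by rewrite ltxx.
apply: le_lt_trans BM _.
have R1 : \int[mu]_(y in `[v2, v1]) normc (g (u1 +i* y)) < c * d / 8.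
  by apply: Rlt U1; [exact: ngy|move=> t; exact: normc_ge0|lra|lra].
have R2 : \int[mu]_(y in `[v2, v1]) normc (g (u2 +i* y)) < c * d / 8.
  by apply: Rlt U2; [exact: ngy|move=> t; exact: normc_ge0|lra|lra].
have R3 : \int[mu]_(x in `[u2, u1]) normc (g (x +i* v1)) < c * d / 8.
  by apply: Rlt V1; [exact: ngx|move=> t; exact: normc_ge0|lra|lra].
have R4 : \int[mu]_(x in `[u2, u1]) normc (g (x +i* v2)) < c * d / 8.
  by apply: Rlt V2; [exact: ngx|move=> t; exact: normc_ge0|lra|lra].
have -> : d * c = 2 * (c * d / 8 + c * d / 8 + (c * d / 8 + c * d / 8)) by field.
by rewrite ltr_pM2l// ltrD// ltrD.
Qed.

End square_mean.

(** * Local estimates for arbitrary exponents *)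

Section power_mean.
Context {R : realType}.
Local Open Scope complex_scope.
Local Notation mu := (@lebesgue_measure R).
Local Notation mu2 := (mu \x mu)%E.

(* The maximum point of rho ^ N |g|, with rho the distance to the boundary of
   the square: around it |g| does not grow by more than a constant factor
   at scale rho. *)
Lemma boundary_weighted_max (g : R[i] -> R[i]) (x0 y0 : R) (N : nat) :
  entire g -> (0 < N)%N -> g (x0 +i* y0) != 0 ->
  exists x1 y1 rho : R, [/\ 0 < rho <= 1,
    `|x1 - x0| <= 1 - rho, `|y1 - y0| <= 1 - rho,
    normc (g (x0 +i* y0)) <= rho ^+ N * normc (g (x1 +i* y1)) &
    forall q, square x1 y1 (rho / 2) q ->
      normc (g (q.1 +i* q.2)) <= 2 ^+ N * normc (g (x1 +i* y1))].
Proof.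
move=> eg N0 gz0.
pose rho (q : R * R) := 1 - Num.max `|q.1 - x0| `|q.2 - y0|.
pose n (q : R * R) := normc (g (q.1 +i* q.2)).
have rholip q q' e : `|q'.1 - q.1| <= e -> `|q'.2 - q.2| <= e ->
    `|rho q' - rho q| <= e.
  move=> q1 q2.
  have M (s t s' t' : R) : `|s' - s| <= e -> `|t' - t| <= e ->
      `|1 - Num.max s' t' - (1 - Num.max s t)| <= e.
    rewrite !ler_norml => /andP[? ?] /andP[? ?].
    by apply/andP; case: (leP s' t'); case: (leP s t) => ? ?; split; lra.
  apply: M; (apply: le_trans (ler_dist_dist _ _) _); [move: q1|move: q2];
    by apply: le_trans; rewrite le_eqVlt; apply/orP; left; apply/eqP;
      congr (`|_|); ring.
have crho : continuous rho.
  apply: jcontinuous_continuous => q e e0; exists (e / 2); first by rewrite divr_gt0.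
  move=> q' /ltW q1 /ltW q2; apply: le_lt_trans (rholip _ _ _ q1 q2) _.
  by lra.
have cn : continuous n.
  apply: jcontinuous_continuous.
  exact: jcontinuous_complex ler_dist_normc (ccontinuous_entire eg).
have cpsi : continuous (fun q => rho q ^+ N * n q).
  move=> q; apply: cvgM; last exact: cn.
  exact: (continuous_comp (crho q) (@exprn_continuous _ N _)).
have cptS : compact (square x0 y0 1).
  by apply: compact_setX; exact: segment_compact.
have z0S : square x0 y0 1 (x0, y0) by apply/squareE; rewrite /= !subrr normr0.
have [] := @compact_EVT_max _ R (fun q => rho q ^+ N * n q) _
  (ex_intro _ _ z0S) cptS.
  exact: continuous_subspaceT.
move=> [x1 y1]; rewrite inE => S1 max1.
have rho0 : rho (x0, y0) = 1.
  by rewrite /rho /= !subrr normr0 maxxx subr0.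
have r1x q : `|q.1 - x0| <= 1 - rho q /\ `|q.2 - y0| <= 1 - rho q.
  by rewrite /rho opprB addrCA subrr addr0 !le_max !lexx orbT.
have n0 : 0 < n (x0, y0) by exact: normc_gt0.
have lez0 : n (x0, y0) <= rho (x1, y1) ^+ N * n (x1, y1).
  by have := max1 _ (mem_set z0S); rewrite rho0 expr1n mul1r.
have rge0 : 0 <= rho (x1, y1).
  by move/squareE : S1 => [? ?]; rewrite /rho subr_ge0 ge_max; apply/andP.
have rgt0 : 0 < rho (x1, y1).
  (* On the boundary the weighted function is zero because [N] is positive, so the maximum is not
     attained there. *)
  rewrite lt_neqAle rge0 andbT eq_sym; apply/eqP => r0; move: lez0.
  by rewrite r0 expr0n gtn_eqF// mul0r leNgt n0.
have rle1 : rho (x1, y1) <= 1 by rewrite /rho gerBl le_max normr_ge0.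
exists x1, y1, (rho (x1, y1)); split => //.
- by apply/andP.
- by have [] := r1x (x1, y1).
- by have [] := r1x (x1, y1).
move=> q /squareE[/= q1 q2].
have : `|rho q - rho (x1, y1)| <= rho (x1, y1) / 2 by exact: rholip.
rewrite ler_norml => /andP[rq _].
(* As [rho] is 1-Lipschitz in the max norm, it loses at most half of its value on the smaller
   square; this yields the factor [2 ^+ N]. *)
have hq : rho (x1, y1) / 2 <= rho q by lra.
have Sq : square x0 y0 1 q.
  have [? ?] := r1x q; apply/squareE; split; lra.
have := max1 _ (mem_set Sq).
rewrite -[normc (g (q.1 +i* q.2))]/(n q) -[normc (g _)]/(n (x1, y1)) => mx.
have h0 : 0 < (rho (x1, y1) / 2) ^+ N by rewrite exprn_gt0// divr_gt0.
rewrite -(ler_pM2l h0); apply: le_trans.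
  by apply: le_trans mx; rewrite ler_wpM2r ?normc_ge0// lerXn2r ?nnegrE//; lra.
by rewrite mulrA -exprMn divfK.
Qed.

Lemma le_affine_powR (p B eps : R) : 0 < p -> 0 <= B -> 0 < eps ->
  exists2 K : R, 0 < K & forall G v : R, 0 < G -> 0 <= v <= B * G ->
    v <= eps * G + K * G / G `^ p * v `^ p.
Proof.
move=> p0 B0 e0; have ep0 : 0 < eps `^ p by exact: powR_gt0.
exists ((B + 1) / eps `^ p); first by rewrite divr_gt0//; lra.
move=> G v G0 /andP[v0 vB]; have Gp : 0 < G `^ p by exact: powR_gt0.
have t0 : 0 <= (B + 1) / eps `^ p * G / G `^ p * v `^ p.
  rewrite mulr_ge0 ?powR_ge0// divr_ge0 ?(ltW Gp)// mulr_ge0 ?(ltW G0)//.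
  by rewrite divr_ge0 ?(ltW ep0)//; lra.
have [vs|vb] := leP v (eps * G); first by lra.
suff H : v <= (B + 1) / eps `^ p * G / G `^ p * v `^ p.
  by have : 0 < eps * G by [exact: mulr_gt0]; lra.
have vp : eps `^ p * G `^ p <= v `^ p.
  rewrite -powRM ?(ltW G0) ?(ltW e0)//; apply: ge0_ler_powR; rewrite ?nnegrE//.
  - exact: ltW.
  - by rewrite mulr_ge0// ltW.
  - exact: ltW.
have -> : (B + 1) / eps `^ p * G / G `^ p * v `^ p =
    (B + 1) * G * (v `^ p / (eps `^ p * G `^ p)).
  by field; rewrite !gt_eqF.
have : 1 <= v `^ p / (eps `^ p * G `^ p).
  by rewrite ler_pdivlMr ?mul1r// mulr_gt0.
move=> /(ler_wpM2l (_ : 0 <= (B + 1) * G)); rewrite mulr1 => H.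
apply: le_trans (H _); last by rewrite mulr_ge0//; lra.
by rewrite mulrDl mul1r; lra.
Qed.

Lemma measurable_powR_entire (g : R[i] -> R[i]) (p : R) : entire g ->
  measurable_fun [set: R * R] (fun q => normc (g (q.1 +i* q.2)) `^ p).
Proof.
move=> eg.
exact: (measurableT_comp (measurable_powR p) (measurable_normc_entire eg)).
Qed.

(** At the weighted maximum point, [square_mean] bounds G d^2 by an integral of |g|;
    [le_affine_powR] replaces it by an integral of |g|^p plus a term absorbed on the left. The
    weight then carries the bound back to the centre. *)
Lemma power_mean (p : R) : 0 < p -> exists2 C : R, 0 < C &
  forall (g : R[i] -> R[i]) (x0 y0 : R), entire g ->
  ((normc (g (x0 +i* y0)) `^ p)%:E <= C%:E *
   \int[mu2]_(q in square x0 y0 1) (normc (g (q.1 +i* q.2)) `^ p)%:E)%E.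
Proof.
(* With N p >= 2 and rho <= 1, the factor rho^(N p) is at most rho^2 = 4 d^2, the scale at which the
   estimate at the maximum point holds. *)
move=> p0; pose N := (Num.truncn (2 / p)).+1.
have Np : 2 <= N%:R * p.
  by rewrite -ler_pdivrMr//; apply: ltW; exact: Num.Theory.truncnS_gt.
(* The constant 16 of [square_mean] and the area 4 d^2 turn [128^-1] into one half, so half of G d^2
   is absorbed. *)
have [||K K0 HK] := @le_affine_powR p (2 ^+ N) 128^-1 p0.
- by rewrite exprn_ge0.
- by rewrite invr_gt0.
exists (128 * K); first by rewrite mulr_gt0.
move=> g x0 y0 eg.
pose k (q : R * R) : \bar R := (normc (g (q.1 +i* q.2)) `^ p)%:E.
have k0 q : (0 <= k q)%E by rewrite lee_fin powR_ge0.
have mk : measurable_fun [set: R * R] k.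
  by apply/measurable_EFinP; exact: measurable_powR_entire.
have I0 : (0 <= \int[mu2]_(q in square x0 y0 1) k q)%E.
  by apply: integral_ge0 => q _; exact: k0.
have [gz0|gz0] := eqVneq (g (x0 +i* y0)) 0.
  rewrite gz0 normc0 powR0 ?gt_eqF// mule_ge0//.
  by rewrite lee_fin mulr_ge0// ltW.
have [x1 [y1 [rho [/andP[r0 r1] xr yr lez0 near]]]] :=
  @boundary_weighted_max g x0 y0 N eg (ltn0Sn _) gz0.
set G := normc (g (x1 +i* y1)) in lez0 near.
have ng0 : 0 < normc (g (x0 +i* y0)) by exact: normc_gt0.
have G0 : 0 < G.
  have : 0 < rho ^+ N * G by exact: lt_le_trans lez0.
  by rewrite pmulr_rgt0// exprn_gt0.
pose d := rho / 2; have d0 : 0 < d by rewrite divr_gt0.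
have sub : square x1 y1 d `<=` square x0 y0 1.
  move=> q /squareE[q1 q2]; apply/squareE.
  by move: q1 q2 xr yr; rewrite /d !ler_norml => /andP[? ?] /andP[? ?]
    /andP[? ?] /andP[? ?]; split; apply/andP; split; lra.
have Gp0 : 0 < G `^ p by exact: powR_gt0.
pose c := K * G / G `^ p.
have c0 : 0 < c by rewrite divr_gt0// mulr_gt0.
have S1 := @square_mean _ g x1 y1 d eg d0.
have S2 : (\int[mu2]_(q in square x1 y1 d) (normc (g (q.1 +i* q.2)))%:E <=
    (128^-1 * G)%:E * (4 * d ^+ 2)%:E +
    c%:E * \int[mu2]_(q in square x0 y0 1) k q)%E.
  apply: (@le_trans _ _ (\int[mu2]_(q in square x1 y1 d)
      ((128^-1 * G)%:E + c%:E * k q))%E).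
    apply: ge0_le_integral => //.
    - exact: measurable_square.
    - by move=> q _; rewrite lee_fin normc_ge0.
    - apply/measurable_EFinP; apply: measurable_funTS.
      exact: measurable_normc_entire.
    - apply: emeasurable_funD; first exact: measurable_cst.
      by apply: measurable_funeM; exact: measurable_funTS.
    - move=> q Sq; rewrite -EFinM -EFinD lee_fin; apply: HK => //.
      by rewrite normc_ge0/=; exact: near.
  have mS := measurable_square x1 y1 d.
  rewrite ge0_integralD//; last 3 first.
  - by move=> q _; rewrite lee_fin mulr_ge0 ?invr_ge0// ltW.
  - by move=> q _; rewrite mule_ge0// lee_fin ltW.
  - by apply: measurable_funeM; exact: measurable_funTS.
  have -> : (\int[mu2]_(q in square x1 y1 d) (128^-1 * G)%:E =
      (128^-1 * G)%:E * (4 * d ^+ 2)%:E)%E.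
    rewrite integral_cst//; congr (_ * _)%E.
    by apply: square_area; exact: ltW.
  rewrite leeD2l//.
  rewrite ge0_integralZl_EFin//; last 2 first.
  - exact: measurable_funTS.
  - exact: ltW.
  rewrite lee_pmul2l// ?lte_fin//; apply: ge0_subset_integral => //.
  - exact: measurable_square.
  - exact: measurable_funTS.
move: S1 S2 I0; rewrite -/k.
(* An infinite integral makes the claim trivial; absorption needs a real one. *)
case: (\int[mu2]_(q in square x0 y0 1) k q)%E => [i| |] //; last first.
  by move=> _ _ _; rewrite gt0_muley ?leey// lte_fin mulr_gt0.
move=> S1 S2 i0.
have {S1 S2} : ((G * d ^+ 2)%:E <= 16%:E * ((128^-1 * G)%:E * (4 * d ^+ 2)%:E +
    c%:E * i%:E))%E.
  by apply: le_trans S1 _; rewrite lee_pmul2l// lte_fin.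
rewrite -!EFinM !lee_fin => S.
have {S} : d ^+ 2 * G `^ p <= 32 * K * i.
  rewrite -(ler_pM2r (_ : 0 < G / G `^ p)) ?divr_gt0//.
  have -> : d ^+ 2 * G `^ p * (G / G `^ p) = G * d ^+ 2.
    by field; rewrite gt_eqF.
  have -> : 32 * K * i * (G / G `^ p) = 32 * (c * i).
    by rewrite /c; field; rewrite gt_eqF.
  by move: S; lra.
move=> S; apply: (@le_trans _ _ (4 * (d ^+ 2 * G `^ p))); last by lra.
apply: (@le_trans _ _ ((rho ^+ N * G) `^ p)).
  apply: ge0_ler_powR; rewrite ?nnegrE ?(ltW p0) ?(ltW ng0)//.
  by rewrite mulr_ge0 ?exprn_ge0 ?(ltW r0) ?(ltW G0).
rewrite powRM ?exprn_ge0 ?(ltW r0) ?(ltW G0)// mulrA ler_pM2r//.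
have -> : 4 * d ^+ 2 = rho ^+ 2 by rewrite /d; field.
rewrite -powR_mulrn ?(ltW r0)// -powRrM -[leRHS]powR_mulrn ?(ltW r0)//.
by apply: ger_powR => //; apply/andP.
Qed.

End power_mean.

(** * Local estimates with the Gaussian weight *)

Section gaussian_mean.
Context {R : realType}.
Local Open Scope complex_scope.
Local Notation mu := (@lebesgue_measure R).
Local Notation mu2 := (mu \x mu)%E.

Definition gaussian_density (p alpha : R) (f : R[i] -> R[i]) (q : R * R) : R :=
  normc (f (q.1 +i* q.2)) `^ p * expR (- (alpha * (q.1 ^+ 2 + q.2 ^+ 2))).

Lemma gaussian_density_ge0 p alpha f q : 0 <= gaussian_density p alpha f q.
Proof. by rewrite mulr_ge0 ?powR_ge0 ?expR_ge0. Qed.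

Lemma measurable_sqr_plane :
  measurable_fun [set: R * R] (fun q : R * R => q.1 ^+ 2 + q.2 ^+ 2).
Proof.
by apply: measurable_funD; apply: measurable_funX;
  [exact: measurable_fst|exact: measurable_snd].
Qed.

Lemma measurable_gaussian_density p alpha f : entire f ->
  measurable_fun [set: R * R] (gaussian_density p alpha f).
Proof.
move=> ef; apply: measurable_funM; first exact: measurable_powR_entire.
apply: measurableT_comp; first exact: measurable_expR.
apply: measurableT_comp; first exact: oppr_measurable.
by apply: measurable_funM; [exact: measurable_cst|exact: measurable_sqr_plane].
Qed.

(** For a complex zeta, |1 + zeta|^2 = 1 + 2 Re zeta + |zeta|^2 is at most the exponential of 2 Re
    zeta + |zeta|^2; this is raised to the power n p / 2. *)
Lemma normc_affine_pow_le (a b s t p : R) n : 0 < p ->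
  normc ((1 + (a +i* b) * (s +i* t)) ^+ n) `^ p <=
  expR (n%:R * p * (a * s - b * t)
        + n%:R * p / 2 * ((a ^+ 2 + b ^+ 2) * (s ^+ 2 + t ^+ 2))).
Proof.
move=> p0; set u := 2 * (a * s - b * t) + (a ^+ 2 + b ^+ 2) * (s ^+ 2 + t ^+ 2).
have nm : normc (1 + (a +i* b) * (s +i* t)) <= expR (u / 2).
  rewrite -(@ler_pXn2r _ 2) ?nnegrE ?normc_ge0 ?expR_ge0//= sqr_sqrtr; last first.
    by rewrite addr_ge0 ?sqr_ge0.
  rewrite -expRM_natl (_ : 2 * (u / 2) = u); last by field.
  by apply: le_trans (expR_ge1Dx u); rewrite /u le_eqVlt; apply/orP; left;
    apply/eqP; ring.
rewrite normcX; apply: (@le_trans _ _ ((expR (u / 2) ^+ n) `^ p)).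
  apply: ge0_ler_powR; rewrite ?nnegrE ?exprn_ge0 ?normc_ge0 ?expR_ge0//.
    exact: ltW.
  by rewrite lerXn2r ?nnegrE ?normc_ge0 ?expR_ge0.
rewrite -expRM_natl -expRM ler_expR /u le_eqVlt; apply/orP; left.
by apply/eqP; field.
Qed.

(* The multiplier (1 + b (w - z0)) ^ n, with n b = - (2 alpha / p) conj z0,
   plays the role of exp (- (2 alpha / p) conj z0 (w - z0)), which makes
   |f|^p exp (- alpha |.|^2) comparable to the p-th power of the modulus of an
   entire function on the square of side 2 around z0, uniformly in z0. *)
Lemma gaussian_mean (p alpha : R) : 0 < p -> 0 < alpha ->
  exists2 C : R, 0 < C & forall (f : R[i] -> R[i]) (q0 : R * R), entire f ->
  ((gaussian_density p alpha f q0)%:E <= C%:E *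
   \int[mu2]_(q in square q0.1 q0.2 1) (gaussian_density p alpha f q)%:E)%E.
Proof.
move=> p0 al0; have [C C0 HC] := power_mean p0.
exists (C * expR (2 * alpha + p)); first by rewrite mulr_gt0// expR_gt0.
move=> f [x0 y0] ef /=.
pose l := 2 * alpha / p; have l0 : 0 < l by rewrite divr_gt0// mulr_gt0.
(* [c2] is |l z0|^2. Taking [n] above it keeps the quadratic error in the exponent of
   [normc_affine_pow_le] below [p], uniformly in the centre. *)
pose c2 := l ^+ 2 * (x0 ^+ 2 + y0 ^+ 2).
pose n := (Num.truncn c2).+1.
have n0 : 0 < n%:R :> R by [].
have cn : c2 <= n%:R by apply: ltW; exact: Num.Theory.truncnS_gt.
pose a := - (l * x0) / n%:R; pose b := l * y0 / n%:R.
pose m (w : R[i]) := 1 + (a +i* b) * (w - (x0 +i* y0)).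
have em : entire m.
  rewrite (_ : m = fun w => (a +i* b) * (w - (x0 +i* y0)) - (-1)); last first.
    by apply/funext => w; rewrite opprK addrC.
  move=> z; apply: C_differentiable_at_sub_cst; apply: C_differentiable_atM.
    exact: entire_cst.
  by apply: C_differentiable_at_sub_cst; exact: entire_id.
have eg : entire (fun w => f w * m w ^+ n) by apply: entireM => //; exact: entireX.
(* From |w|^2 = |z0|^2 + 2 Re (conj(z0) (w - z0)) + |w - z0|^2 and |w - z0|^2 <= 2 on the square;
   the last [p] pays for the quadratic error. *)
set D := expR (alpha * (x0 ^+ 2 + y0 ^+ 2) + (2 * alpha + p)).
have bound q : square x0 y0 1 q ->
    normc (f (q.1 +i* q.2) * m (q.1 +i* q.2) ^+ n) `^ p <=
    D * gaussian_density p alpha f q.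
  move=> /squareE[q1 q2]; rewrite normcM powRM ?normc_ge0//.
  rewrite mulrCA ler_wpM2l ?powR_ge0// -expRD.
  apply: le_trans (normc_affine_pow_le a b (q.1 - x0) (q.2 - y0) n p0) _.
  rewrite ler_expR.
  have E1 : n%:R * p * (a * (q.1 - x0) - b * (q.2 - y0)) =
      - (2 * alpha * (x0 * (q.1 - x0) + y0 * (q.2 - y0))).
    by rewrite /a /b /l; field; rewrite !gt_eqF.
  have st1 : (q.1 - x0) ^+ 2 <= 1.
    by rewrite -real_normK ?num_real// exprn_ile1.
  have st2 : (q.2 - y0) ^+ 2 <= 1.
    by rewrite -real_normK ?num_real// exprn_ile1.
  have E2 : n%:R * p / 2 * ((a ^+ 2 + b ^+ 2) *
      ((q.1 - x0) ^+ 2 + (q.2 - y0) ^+ 2)) <= p.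
    have -> : a ^+ 2 + b ^+ 2 = c2 / n%:R ^+ 2.
      by rewrite /a /b /c2; field; rewrite gt_eqF.
    have -> : n%:R * p / 2 * (c2 / n%:R ^+ 2 *
        ((q.1 - x0) ^+ 2 + (q.2 - y0) ^+ 2)) =
        p * (c2 / n%:R) * (((q.1 - x0) ^+ 2 + (q.2 - y0) ^+ 2) / 2).
      by field; rewrite gt_eqF.
    have h1 : c2 / n%:R <= 1 by rewrite ler_pdivrMr// mul1r.
    have h0 : 0 <= c2 / n%:R.
      by rewrite divr_ge0// /c2 mulr_ge0 ?addr_ge0 ?sqr_ge0.
    have h2 : 0 <= ((q.1 - x0) ^+ 2 + (q.2 - y0) ^+ 2) / 2.
      by rewrite divr_ge0 ?addr_ge0 ?sqr_ge0.
    rewrite -[leRHS]mulr1 -mulrA ler_pM2l//.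
    by rewrite mulr_ile1//; lra.
  rewrite E1; nra.
have gz0 : f (x0 +i* y0) * m (x0 +i* y0) ^+ n = f (x0 +i* y0).
  by rewrite /m subrr mulr0 addr0 expr1n mulr1.
have := HC _ x0 y0 eg; rewrite gz0 => S.
have mk : measurable_fun [set: R * R]
    (fun q => (gaussian_density p alpha f q)%:E).
  by apply/measurable_EFinP; exact: measurable_gaussian_density.
have k0 q : (0 <= (gaussian_density p alpha f q)%:E)%E.
  by rewrite lee_fin gaussian_density_ge0.
have mS := measurable_square x0 y0 1.
have {}S : ((normc (f (x0 +i* y0)) `^ p)%:E <= C%:E * (D%:E *
    \int[mu2]_(q in square x0 y0 1) (gaussian_density p alpha f q)%:E))%E.
  apply: le_trans S _; rewrite lee_pmul2l// ?lte_fin//.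
  rewrite -ge0_integralZl_EFin ?expR_ge0//; last exact: measurable_funTS.
  apply: ge0_le_integral => //.
  - by move=> q _; rewrite lee_fin powR_ge0.
  - apply/measurable_EFinP; apply: measurable_funTS.
    exact: (measurable_powR_entire p eg).
  - by apply: measurable_funeM; exact: measurable_funTS.
have e0 : 0 < expR (- (alpha * (x0 ^+ 2 + y0 ^+ 2))) by exact: expR_gt0.
rewrite /gaussian_density /= [X in X%:E]mulrC EFinM.
move: S; rewrite -(lee_pmul2l _ (_ : 0 < (expR (- (alpha * (x0 ^+ 2 + y0 ^+ 2))))%:E)%E)//.
move=> /le_trans; apply; rewrite !muleA -!EFinM le_eqVlt; apply/orP; left.
apply/eqP; congr (_%:E * _)%E; rewrite /D expRD expRN.
by field; rewrite gt_eqF// expR_gt0.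
Qed.

End gaussian_mean.

(** * Arcs of circles *)

Section arcs.
Context {R : realType}.
Local Notation mu := (@lebesgue_measure R).

(** The set lies in the segment of radius [D] around any of its points. *)
Lemma lebesgue_measure_diameter (A : set R) (D : R) : measurable A -> 0 <= D ->
  (forall s t, A s -> A t -> `|s - t| <= D) -> (mu A <= (2 * D)%:E)%E.
Proof.
move=> mA D0 H; have [->|/set0P[t At]] := eqVneq A set0.
  by rewrite measure0 lee_fin mulr_ge0.
have -> : 2 * D = t + D - (t - D) by ring.
rewrite -lebesgue_measure_segment; last by lra.
apply: le_measure; rewrite ?inE//.
by move=> s As /=; rewrite in_itv/= -ler_distl; exact: H.
Qed.

(** With u = |s - t| / 2, the squared chord is 4 sin(u)^2, and the mean value theorem gives sin u >=
    cos(pi / 4) u for u <= pi / 4. *)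
Lemma chord_lower_bound : exists2 k : R, 0 < k & forall s t : R,
  `|s - t| <= pi / 2 ->
  k * `|s - t| ^+ 2 <= (cos s - cos t) ^+ 2 + (sin s - sin t) ^+ 2.
Proof.
have pi0 : 0 < pi :> R := pi_gt0 R.
have k0 : 0 < cos (pi / 4) :> R.
  by apply: cos_gt0_pihalf; apply/andP; split; lra.
exists (cos (pi / 4) ^+ 2); first by rewrite exprn_gt0.
move=> s t st; set u := `|s - t| / 2.
have u0 : 0 <= u by rewrite divr_ge0.
have -> : (cos s - cos t) ^+ 2 + (sin s - sin t) ^+ 2 = 4 * sin u ^+ 2.
  have c1 : cos (s - t) = 1 - 2 * sin u ^+ 2.
    rewrite -cos_norm (_ : `|s - t| = u *+ 2).
      by rewrite cos_mulr2n cos2sin2 -mulr_natl; ring.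
    by rewrite /u -mulr_natl; field.
  have -> : (cos s - cos t) ^+ 2 + (sin s - sin t) ^+ 2 =
      (cos s ^+ 2 + sin s ^+ 2) + (cos t ^+ 2 + sin t ^+ 2)
      - 2 * (cos s * cos t + sin s * sin t) by ring.
  by rewrite !cos2Dsin2 -cosB c1; ring.
have [c] := @MVT_segment _ (@sin R) (@cos R) 0 u u0
  (fun x _ => is_derive_sin x) (continuous_subspaceT (@continuous_sin R)).
rewrite in_itv/= sin0 !subr0 => /andP[c0 cu] ->.
have ck : cos (pi / 4) <= cos c.
  rewrite /u in cu; rewrite leNgt ltr_cos ?in_itv/=; [|apply/andP; split; lra..].
  by rewrite -leNgt; lra.
have -> : `|s - t| = 2 * u by rewrite /u; field.
have -> : cos (pi / 4) ^+ 2 * (2 * u) ^+ 2 = 4 * (cos (pi / 4) ^+ 2 * u ^+ 2).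
  by ring.
rewrite (exprMn 2 (cos c)) ler_pM2l// ler_wpM2r ?sqr_ge0//.
by rewrite lerXn2r ?nnegrE// ?(ltW k0)// (le_trans (ltW k0)).
Qed.

(** All real angles are included; one period is selected where the measure is taken. *)
Definition arc (r : R) (q : R * R) : set R :=
  [set t | square q.1 q.2 1 (r * cos t, r * sin t)].

Lemma measurable_arc r q : measurable (arc r q).
Proof.
rewrite (_ : arc r q = (fun t => r * cos t) @^-1` `[q.1 - 1, q.1 + 1] `&`
   (fun t => r * sin t) @^-1` `[q.2 - 1, q.2 + 1]); last first.
  by apply/seteqP; split => t.
have mr (h : R -> R) : continuous h -> measurable_fun setT (fun t => r * h t).
  move=> ch; apply: measurable_funM; first exact: measurable_cst.
  exact: continuous_measurable_fun.
apply: measurableI; rewrite -[X in measurable X]setTI; apply: mr => //;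
  solve [exact: continuous_cos|exact: continuous_sin|exact: measurable_itv].
Qed.

(** Two points of the circle in the same square differ by at most 2 in each coordinate, so their
    squared chord is at most 8 and [chord_lower_bound] gives |s - t| <= D / r. That bound needs |s -
    t| <= pi / 2, hence the four quarter periods, each of measure at most 2 D / r. *)
Lemma arc_measure : exists2 C : R, 0 < C & forall (r : R) (q : R * R), 0 < r ->
  (mu (`[0%R, (2 * pi)%R] `&` arc r q) <= (C / r)%:E)%E.
Proof.
have [k k0 Hk] := chord_lower_bound.
have pi0 : 0 < pi :> R := pi_gt0 R.
pose D := Num.sqrt (8 / k).
have D0 : 0 < D by rewrite sqrtr_gt0 divr_gt0.
exists (8 * D); first by rewrite mulr_gt0.
move=> r q r0.
have quarter (a : R) :
    (mu (`[a, (a + pi / 2)%R] `&` arc r q) <= (2 * (D / r))%:E)%E.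
  apply: lebesgue_measure_diameter.
  - by apply: measurableI; [exact: measurable_itv|exact: measurable_arc].
  - by rewrite divr_ge0// ltW.
  move=> s t [] /=; rewrite !in_itv/= => /andP[s1 s2] /squareE[/= cs ss].
  move=> [] /= /andP[t1 t2] /squareE[/= ct st].
  have {}Hk := Hk s t; have st' : `|s - t| <= pi / 2.
    by rewrite ler_norml; apply/andP; split; lra.
  have dist (a1 b1 c1 : R) : `|r * a1 - c1| <= 1 -> `|r * b1 - c1| <= 1 ->
      r ^+ 2 * (a1 - b1) ^+ 2 <= 4.
    move=> A B; rewrite -exprMn -real_normK ?num_real//.
    have : `|r * (a1 - b1)| <= 2.
      have -> : r * (a1 - b1) = (r * a1 - c1) - (r * b1 - c1) by ring.
      by apply: le_trans (ler_normB _ _) _; lra.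
    have := normr_ge0 (r * (a1 - b1)); move: `|_| => v v0 v2.
    by rewrite expr2; nra.
  have dc := dist _ _ _ cs ct; have ds := dist _ _ _ ss st.
  have {}Hk := Hk st'.
  rewrite -(@ler_pXn2r _ 2) ?nnegrE ?divr_ge0 ?(ltW D0) ?(ltW r0)//.
  rewrite expr_div_n /D sqr_sqrtr ?divr_ge0 ?(ltW k0)//.
  rewrite ler_pdivlMr ?exprn_gt0// ler_pdivlMr//.
  apply: (@le_trans _ _ (r ^+ 2 * ((cos s - cos t) ^+ 2 + (sin s - sin t) ^+ 2))).
    rewrite (_ : _ * k = r ^+ 2 * (k * `|s - t| ^+ 2)); last by ring.
    by rewrite ler_pM2l ?exprn_gt0.
  by rewrite mulrDr; lra.
have mQ (a : R) : measurable (`[a, a + pi / 2] `&` arc r q).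
  by apply: measurableI; [exact: measurable_itv|exact: measurable_arc].
pose Q (a : R) := `[a, a + pi / 2]%classic `&` arc r q.
have cover : `[0, 2 * pi]%classic `&` arc r q `<=`
    (Q 0 `|` Q (pi / 2)) `|` (Q pi `|` Q (pi + pi / 2)).
  move=> t [] /=; rewrite in_itv/= => /andP[t0 t2] at_.
  rewrite /Q /= !in_itv/=.
  have [h1|h1] := leP t pi; [left|right].
    have [h2|h2] := leP t (pi / 2); [left|right]; split=> //;
      by apply/andP; split; lra.
  have [h2|h2] := leP t (pi + pi / 2); [left|right]; split=> //;
    by apply/andP; split; lra.
apply: (@le_trans _ _ (mu ((Q 0 `|` Q (pi / 2)) `|` (Q pi `|` Q (pi + pi / 2))))).
  apply: le_measure => //; rewrite inE.
  - by apply: measurableI; [exact: measurable_itv|exact: measurable_arc].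
  - by apply: measurableU; apply: measurableU; exact: mQ.
have -> : 8 * D / r = 2 * (D / r) + 2 * (D / r) + (2 * (D / r) + 2 * (D / r)).
  by field; rewrite gt_eqF.
have U2 (A B : set R) (v w : R) : measurable A -> measurable B ->
    (mu A <= v%:E)%E -> (mu B <= w%:E)%E -> (mu (A `|` B) <= (v + w)%:E)%E.
  move=> mA mB Av Bw; rewrite EFinD.
  apply: (@le_trans _ _ (mu A + mu B)%E); last exact: leeD.
  by apply: measureU2.
apply: (U2); first by apply: measurableU; exact: mQ.
- by apply: measurableU; exact: mQ.
- by apply: U2; [exact: mQ|exact: mQ|exact: quarter|exact: quarter].
- by apply: U2; [exact: mQ|exact: mQ|exact: quarter|exact: quarter].
Qed.

End arcs.

Section plane_measure.
Context {R : realType}.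
Local Notation mu := (@lebesgue_measure R).

(* A renaming of mu \x mu: the library's sigma-finiteness instance for products
   is shadowed by the one for subprobabilities. *)
Definition plane_measure : set (measurableTypeR R * measurableTypeR R) -> \bar R :=
  (mu \x mu)%E.

HB.instance Definition _ := Measure.on plane_measure.

Lemma plane_measure_sigma_finite : sigma_finite setT plane_measure.
Proof.
exists (fun n => square 0 0 n%:R); last first.
  move=> n; split; first exact: measurable_square.
  by rewrite /plane_measure square_area ?ltry.
apply/esym/seteqP; split => // q _.
exists (Num.truncn (Num.max `|q.1| `|q.2|)).+1 => //; apply/squareE.
rewrite !subr0; split; apply: ltW;
  apply: le_lt_trans (Num.Theory.truncnS_gt _); by rewrite le_max lexx ?orbT.
Qed.

HB.instance Definition _ := Measure_isSigmaFinite.Build _ _ _ plane_measure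
  plane_measure_sigma_finite.

End plane_measure.

(** * From circle means to exterior integrals *)

Section circle_bound.
Context {R : realType}.
Local Open Scope complex_scope.
Local Notation mu := (@lebesgue_measure R).
Local Notation mu2 := (mu \x mu)%E.

(** For [r >= 0], the complement of the open disc of radius [r / 2], with squared radii. *)
Definition exterior (r : R) : set (R * R) :=
  [set q | r ^+ 2 / 4 <= q.1 ^+ 2 + q.2 ^+ 2].

Lemma measurable_exterior r : measurable (exterior r).
Proof.
rewrite (_ : exterior r = (fun q : R * R => q.1 ^+ 2 + q.2 ^+ 2) @^-1`
  `[r ^+ 2 / 4, +oo[); last first.
  by apply/seteqP; split => q /=; rewrite in_itv/= andbT.
rewrite -[X in measurable X]setTI; apply: measurable_sqr_plane => //.
Qed.

(** Written exactly as the integrand of [weighted_integral], so that the finiteness hypothesis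
    applies by conversion. *)
Definition weight (p alpha : R) (f : R[i] -> R[i]) (q : R * R) : R :=
  normc (f (q.1 +i* q.2)) `^ p * (q.1 ^+ 2 + q.2 ^+ 2)
    * expR (- (alpha * (q.1 ^+ 2 + q.2 ^+ 2))).

Lemma weightE p alpha f q :
  weight p alpha f q = (q.1 ^+ 2 + q.2 ^+ 2) * gaussian_density p alpha f q.
Proof. by rewrite /weight /gaussian_density mulrA (mulrC (q.1 ^+ 2 + _)). Qed.

Lemma weight_ge0 p alpha f q : 0 <= weight p alpha f q.
Proof.
by rewrite weightE mulr_ge0 ?gaussian_density_ge0// addr_ge0 ?sqr_ge0.
Qed.

Lemma measurable_weight p alpha f : entire f ->
  measurable_fun [set: R * R] (weight p alpha f).
Proof.
move=> ef; rewrite (_ : weight p alpha f = fun q =>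
  (q.1 ^+ 2 + q.2 ^+ 2) * gaussian_density p alpha f q).
  apply: measurable_funM; first exact: measurable_sqr_plane.
  exact: measurable_gaussian_density.
by apply/funext => q; rewrite weightE.
Qed.

(** The component [w] of [q] along the direction [t] is at least [r - 2], and [r - 2 >= r / 2]
    because [r >= 4]. *)
Lemma arc_sub_exterior (r : R) (q : R * R) (t : R) : 4 <= r -> arc r q t ->
  exterior r q.
Proof.
move=> r4 /squareE[/=]; rewrite /exterior /= => ct st.
have cs := cos2Dsin2 t; have c1 := cos_max t; have s1 := sin_max t.
pose w := cos t * q.1 + sin t * q.2.
have wr : r - 2 <= w.
  have -> : w = r * (cos t ^+ 2 + sin t ^+ 2)
      - (cos t * (r * cos t - q.1) + sin t * (r * sin t - q.2)).
    by rewrite /w; ring.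
  rewrite cs mulr1 lerD2l lerN2.
  have b (u v : R) : `|u| <= 1 -> `|v| <= 1 -> u * v <= 1.
    move=> u1 v1; rewrite (le_trans (ler_norm _))// normrM.
    by rewrite mulr_ile1.
  by have := b _ _ c1 ct; have := b _ _ s1 st; lra.
have wq : w ^+ 2 <= q.1 ^+ 2 + q.2 ^+ 2.
  have -> : q.1 ^+ 2 + q.2 ^+ 2 = w ^+ 2 + (cos t * q.2 - sin t * q.1) ^+ 2.
    transitivity ((cos t ^+ 2 + sin t ^+ 2) * (q.1 ^+ 2 + q.2 ^+ 2)).
      by rewrite cs mul1r.
    by rewrite /w; ring.
  by rewrite lerDl sqr_ge0.
apply: le_trans wq; have -> : r ^+ 2 / 4 = (r / 2) ^+ 2 by field.
by rewrite lerXn2r ?nnegrE//; lra.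
Qed.

(** The factor [r ^+ 3] is used up by the arc measure, of order 1 / r, and by |q|^2 >= r^2 / 4,
    which inserts the weight |q|^2 at the cost of 4 / r^2. *)
Lemma circle_bound (p alpha : R) : 0 < p -> 0 < alpha ->
  exists2 K : R, 0 < K & forall (f : R[i] -> R[i]) (r : R), entire f -> 4 <= r ->
  ((r ^+ 3)%:E * Mpp p r f * (expR (- (alpha * r ^+ 2)))%:E <=
   K%:E * \int[mu2]_(q in exterior r) (weight p alpha f q)%:E)%E.
Proof.
move=> p0 al0; have [C1 C10 H1] := gaussian_mean p0 al0.
have [C2 C20 H2] := @arc_measure R.
exists (4 * C1 * C2); first by rewrite !mulr_gt0.
move=> f r ef r4; have r0 : 0 < r by lra.
pose A := `[0%R, (2 * pi)%R]%classic : set R.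
have mA : measurable A by exact: measurable_itv.
pose phi := gaussian_density p alpha f.
have mphi : measurable_fun [set: R * R] phi by exact: measurable_gaussian_density.
have phi0 q : 0 <= phi q by exact: gaussian_density_ge0.
have mcos : measurable_fun [set: R] (fun t => r * cos t).
  apply: measurable_funM; first exact: measurable_cst.
  by apply: continuous_measurable_fun; exact: continuous_cos.
have msin : measurable_fun [set: R] (fun t => r * sin t).
  apply: measurable_funM; first exact: measurable_cst.
  by apply: continuous_measurable_fun; exact: continuous_sin.
pose z t := (r * cos t, r * sin t).
have mz : measurable_fun [set: R] z by exact: measurable_fun_pair.
have mphiz : measurable_fun [set: R] (phi \o z) by exact: measurableT_comp.
(* The incidence set of angles and points; the density restricted to it is the kernel whose two
   integrals are exchanged. *)
pose E := [set tq : R * (R * R) | arc r tq.2 tq.1].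
have mE : measurable E.
  pose d1 (tq : R * (R * R)) := r * cos tq.1 - tq.2.1.
  pose d2 (tq : R * (R * R)) := r * sin tq.1 - tq.2.2.
  have md1 : measurable_fun setT d1.
    apply: measurable_funB; first exact: (measurableT_comp mcos measurable_fst).
    exact: (measurableT_comp measurable_fst measurable_snd).
  have md2 : measurable_fun setT d2.
    apply: measurable_funB; first exact: (measurableT_comp msin measurable_fst).
    exact: (measurableT_comp measurable_snd measurable_snd).
  rewrite (_ : E = d1 @^-1` `[-1, 1] `&` d2 @^-1` `[-1, 1]); last first.
    apply/seteqP; split => [tq|tq].
      by rewrite /E /arc => /squareE[/= ? ?]; split; rewrite /= in_itv/= -ler_norml.
    rewrite /E /arc => -[]; rewrite /= !in_itv/= -!ler_norml => ? ?.
    exact/squareE.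
  apply: measurableI; rewrite -[X in measurable X]setTI.
  - by apply: md1 => //; exact: measurable_itv.
  - by apply: md2 => //; exact: measurable_itv.
pose H : R * (R * R) -> \bar R := (fun tq => (phi tq.2)%:E) \_ E.
have H0 tq : (0 <= H tq)%E by apply: erestrict_ge0 => q _; rewrite lee_fin.
have mH : measurable_fun setT H.
  have mp : measurable_fun [set: R * (R * R)] (fun tq => (phi tq.2)%:E).
    by apply/measurable_EFinP; exact: (measurableT_comp mphi measurable_snd).
  exact: measurable_restrict_ereal.
(* Incidence is symmetric: [q] lies in the square around [z t] exactly when [z t] lies in the square
   around [q]. *)
have HE t : (\int[mu2]_(q in square (z t).1 (z t).2 1) (phi q)%:E =
    \int[mu2]_q H (t, q))%E.
  rewrite integral_mkcond; apply: eq_integral => q _.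
  rewrite /H !patchE; congr (if _ then _ else _); apply/idP/idP; rewrite !inE.
    by move=> /squareE[/= qc qs]; apply/squareE => /=; split; rewrite distrC.
  by move=> /squareE[/= qc qs]; apply/squareE => /=; split; rewrite distrC.
(* On the circle the Gaussian factor is constant and moves under the integral. *)
have S1 : (Mpp p r f * (expR (- (alpha * r ^+ 2)))%:E =
    \int[mu]_(t in A) (phi (z t))%:E)%E.
  rewrite /Mpp muleC -ge0_integralZl_EFin ?expR_ge0//.
  - apply: eq_integral => t _; rewrite -EFinM; congr EFin.
    rewrite /phi /gaussian_density mulrC /=; congr (_ * expR (- (alpha * _))).
    by rewrite !exprMn -mulrDr cos2Dsin2 mulr1.
  - by move=> t _; rewrite lee_fin powR_ge0.
  - apply: measurable_funTS; apply/measurable_EFinP.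
    exact: (measurableT_comp (measurable_powR_entire p ef) mz).
pose w := weight p alpha f.
have mw : measurable_fun [set: R * R] (fun q => (w q)%:E).
  by apply/measurable_EFinP; exact: measurable_weight.
have w0 q : 0 <= w q by exact: weight_ge0.
have S3 q : (\int[mu]_(t in A) H (t, q) <=
    (4 * C2 / r ^+ 3)%:E * ((fun q => (w q)%:E) \_ (exterior r)) q)%E.
  have -> : (\int[mu]_(t in A) H (t, q) =
      (phi q)%:E * mu (A `&` arc r q))%E.
    rewrite -integral_cst; last first.
      by apply: measurableI => //; exact: measurable_arc.
    rewrite integral_mkcondr; apply: eq_integral => t _; rewrite /H !patchE.
    by congr (if _ then _ else _); apply/idP/idP; rewrite !inE.
  rewrite patchE; case: ifPn => [|/negP qr]; last first.
    rewrite (_ : A `&` arc r q = set0) ?measure0 ?mule0//.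
    apply/seteqP; split => // t [_ /(arc_sub_exterior r4) qe]; apply: qr.
    by rewrite inE.
  rewrite inE /exterior /= => qr.
  apply: (@le_trans _ _ ((phi q)%:E * (C2 / r)%:E)%E).
    by apply: lee_wpmul2l; [rewrite lee_fin|exact: H2].
  rewrite -!EFinM lee_fin /w weightE -/phi.
  have -> : 4 * C2 / r ^+ 3 * ((q.1 ^+ 2 + q.2 ^+ 2) * phi q) =
      phi q * (C2 / r) * ((q.1 ^+ 2 + q.2 ^+ 2) / (r ^+ 2 / 4)).
    by field; rewrite gt_eqF.
  apply: ler_peMr; first by rewrite mulr_ge0// divr_ge0// ltW.
  by rewrite ler_pdivlMr ?mul1r// divr_gt0// exprn_gt0.
have mW := measurable_restrict_ereal (measurable_exterior r) mw.
have c0 : 0 <= 4 * C2 / r ^+ 3.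
  by rewrite divr_ge0 ?mulr_ge0 ?exprn_ge0 ?(ltW C20) ?(ltW r0).
have S4 : (\int[mu]_(t in A) (phi (z t))%:E <= C1%:E *
    \int[mu2]_q ((4 * C2 / r ^+ 3)%:E * ((fun q => (w q)%:E) \_ (exterior r)) q))%E.
  apply: (@tonelli_domination _ _ _ _ R mu (@plane_measure R) A H _ _ C1 mA mH H0
    _ _ _ (ltW C10) _ S3).
  - exact/measurable_EFinP.
  - by move=> t; rewrite lee_fin.
  - exact: measurable_funeM.
  - by move=> t; rewrite -HE; exact: H1.
rewrite ge0_integralZl_EFin// in S4; last first.
  by move=> q _; apply: erestrict_ge0 => ? _; rewrite lee_fin.
rewrite -integral_mkcond in S4.
rewrite -muleA S1.
have r30 : (0 < (r ^+ 3)%:E :> \bar R)%E by rewrite lte_fin exprn_gt0.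
apply: (@le_trans _ _ ((r ^+ 3)%:E * (C1%:E * ((4 * C2 / r ^+ 3)%:E *
    \int[mu2]_(q in exterior r) (w q)%:E)))%E).
  by rewrite lee_pmul2l.
rewrite !muleA -!EFinM le_eqVlt; apply/orP; left; apply/eqP.
by congr (_%:E * _)%E; field; rewrite gt_eqF.
Qed.

End circle_bound.

(** * Decay of the exterior integral *)

Section exterior_integral.
Context {R : realType}.
Local Notation mu := (@lebesgue_measure R).
Local Notation mu2 := (mu \x mu)%E.
Variable w : R * R -> R.
Hypothesis mw : measurable_fun [set: R * R] w.
Hypothesis w0 : forall q, 0 <= w q.
Hypothesis iw : (\int[mu2]_q (w q)%:E < +oo)%E.

Let mEw : measurable_fun [set: R * R] (fun q => (w q)%:E).
Proof. exact/measurable_EFinP. Qed.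

Lemma exterior_integral_ge0 r : (0 <= \int[mu2]_(q in exterior r) (w q)%:E)%E.
Proof. by apply: integral_ge0 => q _; rewrite lee_fin. Qed.

Lemma exterior_integral_fin_num r :
  (\int[mu2]_(q in exterior r) (w q)%:E)%E \is a fin_num.
Proof.
rewrite ge0_fin_numE ?exterior_integral_ge0//; apply: le_lt_trans iw.
apply: ge0_subset_integral => //; first exact: measurable_exterior.
by move=> q _; rewrite lee_fin.
Qed.

Lemma exterior_integral_le r s : 0 <= r -> r <= s ->
  (\int[mu2]_(q in exterior s) (w q)%:E <=
   \int[mu2]_(q in exterior r) (w q)%:E)%E.
Proof.
move=> r0 rs; apply: ge0_subset_integral.
- exact: measurable_exterior.
- exact: measurable_exterior.
- exact: measurable_funTS.
- by move=> q _; rewrite lee_fin.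
- move=> q; rewrite /exterior /=; apply: le_trans.
  by rewrite ler_pM2r ?invr_gt0// lerXn2r ?nnegrE// (le_trans r0).
Qed.

(** Dominated convergence with dominating function [w]: each point leaves [exterior n%:R] for [n]
    large. *)
Lemma exterior_integral_cvg_nat :
  (\int[mu2]_(q in exterior n%:R) (w q)%:E)%E @[n --> \oo] --> 0%E.
Proof.
pose fn (n : nat) := (fun q => (w q)%:E) \_ (exterior n%:R).
have fnE n : (\int[mu2]_(q in exterior n%:R) (w q)%:E =
    \int[mu2]_q fn n q)%E by rewrite integral_mkcond.
under eq_fun do rewrite fnE.
have mfn n : measurable_fun [set: R * R] (fn n).
  exact: (measurable_restrict_ereal (measurable_exterior _) mEw).
have [] := @dominated_convergence _ _ R mu2 setT measurableT fn (cst 0%E)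
  (fun q => (w q)%:E) mfn (@measurable_cst _ _ _ _ setT 0%E).
- apply: aeW => q _.
  (* For [n >= N], both n > 4 |q|^2 and n >= 1 hold, so n^2 > 4 |q|^2. *)
  pose N := (Num.truncn (4 * (q.1 ^+ 2 + q.2 ^+ 2))).+1.
  apply: cvg_near_cst; exists N => // n /= Nn; rewrite /fn patchE.
  case: ifPn => //; rewrite inE /exterior /= leNgt => /negP[].
  have hN : 4 * (q.1 ^+ 2 + q.2 ^+ 2) < N%:R by exact: Num.Theory.truncnS_gt.
  have n1 : N%:R <= n%:R :> R by rewrite ler_nat.
  have n2 : 1 <= n%:R :> R by rewrite ler1n (leq_trans _ Nn).
  by rewrite ltr_pdivlMr// mulrC; nra.
- apply/integrableP; split => //; apply: le_lt_trans iw.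
  apply: ge0_le_integral => //.
  + exact: measurableT_comp.
  + by move=> q _; rewrite gee0_abs ?lee_fin.
- apply: aeW => q n _; rewrite /fn patchE; case: ifPn => _.
    by rewrite gee0_abs ?lee_fin.
  by rewrite abse0 lee_fin.
by move=> _ _; rewrite integral_cst// mul0e.
Qed.

(** Monotonicity in the radius extends the limit from integers to real [r]. *)
Lemma exterior_integral_cvg :
  fine (\int[mu2]_(q in exterior r) (w q)%:E) @[r --> +oo] --> 0.
Proof.
apply/cvgrPdist_lt => e e0.
have /fine_cvgP[_ /cvgrPdist_lt/(_ _ e0)[N _ HN]] := exterior_integral_cvg_nat.
have /= := HN N (leqnn N).
rewrite !sub0r !normrN ger0_norm ?fine_ge0 ?exterior_integral_ge0// => TN.
near=> r; have Nr : N%:R <= r by near: r; exact: nbhs_pinfty_ge.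
rewrite sub0r normrN ger0_norm ?fine_ge0 ?exterior_integral_ge0//.
apply: le_lt_trans TN; apply: fine_le; rewrite ?exterior_integral_fin_num//.
exact: exterior_integral_le.
Unshelve. all: by end_near. Qed.

End exterior_integral.

(** * Passage to the limit on large circles *)

Unset Implicit Arguments.

Theorem theorem4p4 (R : realType) (alpha p : R) (f : complex R -> complex R) :
  0 < alpha -> 0 < p -> entire f ->
  (weighted_integral p alpha f < +oo)%E ->
  ((r ^+ 3)%:E * Mpp p r f * (expR (- (alpha * r ^+ 2)))%:E)%E
    @[r --> +oo] --> 0%E.
Proof.
move=> al0 p0 ef fin.
have [K K0 HK] := circle_bound p0 al0.
have mw := measurable_weight p alpha ef; have w0 := weight_ge0 p alpha f.
pose T r := (\int[(@lebesgue_measure R \x @lebesgue_measure R)]_(q in exterior r)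
  (weight p alpha f q)%:E)%E.
(* The upper bound is passed through [fine], legitimate since the exterior integrals are finite, so
   that its limit is computed in [R]. *)
apply: (@squeeze_cvge _ _ _ _ (cst 0%E) _ (fun r => (K * fine (T r))%:E)).
- near=> r; have r4 : 4 <= r by near: r; exact: nbhs_pinfty_ge.
  apply/andP; split.
    apply: mule_ge0; last by rewrite lee_fin expR_ge0.
    apply: mule_ge0; first by rewrite lee_fin exprn_ge0//; lra.
    by apply: integral_ge0 => t _; rewrite lee_fin powR_ge0.
  rewrite [leRHS]EFinM fineK; first exact: HK.
  exact: exterior_integral_fin_num.
- exact: cvg_cst.
- apply: cvg_EFin; first by near=> r.
  rewrite -(mulr0 K); apply: cvgM; first exact: cvg_cst.
  exact: exterior_integral_cvg mw w0 fin.
Unshelve. all: by end_near. Qed.
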